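(* Let $-\infty\le a<b\le\infty$ and let $A:(a,b)\to\mathbb{R}^{n\times n}$ be a matrix of measurable, locally essentially bounded functions. The system $$\frac{d}{dt}\Phi(t,t_0)=A(t)\Phi(t,t_0),\qquad \Phi(t_0,t_0)=I,$$ is a totally nonnegative differential system (TNDS) on $(a,b)$ if and only if $A(t)\in\mathbb{M}$ for almost all $t\in(a,b)$.
   Context: A square real matrix is totally nonnegative (TN) if the determinant of every square submatrix (every minor) is nonnegative. For $a<t_0,t<b$, $\Phi(t,t_0)$ denotes the unique locally absolutely continuous solution of the displayed equation (holding for almost every $t$). The system is called a TNDS on $(a,b)$ if $\Phi(t,t_0)$ is TN for all $a<t_0\le t<b$. $\mathbb{M}\subset\mathbb{R}^{n\times n}$ denotes the set of tridiagonal matrices with nonnegative entries on the sub-diagonal and the super-diagonal (the diagonal entries are arbitrary real numbers). *)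

(* Defs.v *)
From HB Require Import structures.
From mathcomp Require Import all_boot all_order all_algebra.
From mathcomp Require Import all_classical all_reals all_analysis measurable_realfun.

Set Implicit Arguments.
Unset Strict Implicit.
Unset Printing Implicit Defensive.

Import Order.TTheory GRing.Theory Num.Theory.
Import numFieldNormedType.Exports.

Local Open Scope classical_set_scope.
Local Open Scope ring_scope.

(* The endpoints of an interval may be infinite. *)
Definition oitv (R : realType) (a b : \bar R) : set R :=
  [set t | (a < t%:E)%E /\ (t%:E < b)%E].

(* The default sigma-algebra on R is the Borel one; this is its completion. *)
Definition lebesgueType (R : realType) :=
  g_sigma_algebraType (completed_algebra_gen (@lebesgue_measure R)).

Definition lebesgue_measurable_fun (R : realType) (D : set R) (f : R -> R) :=
  @measurable_fun _ _ (lebesgueType R) (measurableTypeR R) D f.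

Definition measurable_mx (R : realType) (n : nat) (D : set R)
    (A : R -> 'M[R]_n) :=
  forall i j, lebesgue_measurable_fun D (fun t => A t i j).

(* Here and below, `|M| is the maximum of the absolute values of the entries
   of M. *)
Definition locally_ess_bounded (R : realType) (n : nat) (a b : \bar R)
    (A : R -> 'M[R]_n) :=
  forall c d : R, oitv a b c -> oitv a b d ->
  exists K : R, {ae @lebesgue_measure R, forall t, c <= t <= d -> `|A t| <= K}.

Definition abs_continuous (R : realType) (V : normedModType R) (c d : R)
    (f : R -> V) :=
  forall e : R, 0 < e -> exists2 delta : R, 0 < delta &
  forall (m : nat) (u v : 'I_m -> R),
    (forall i, [/\ c <= u i, u i <= v i & v i <= d]) ->
    trivIset setT (fun i => [set x : R | u i < x < v i]) ->
    \sum_i (v i - u i) < delta ->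
    \sum_i `|f (v i) - f (u i)| < e.

Definition locally_abs_continuous (R : realType) (V : normedModType R)
    (a b : \bar R) (f : R -> V) :=
  forall c d : R, oitv a b c -> oitv a b d -> abs_continuous c d f.

Definition ode_solution (R : realType) (n : nat) (a b : \bar R)
    (A : R -> 'M[R]_n) (t0 : R) (F : R -> 'M[R]_n) :=
  [/\ locally_abs_continuous a b F,
      F t0 = 1%:M &
      {ae @lebesgue_measure R, forall t, oitv a b t ->
         is_derive t 1 F (A t *m F t)}].

Definition transition_matrix (R : realType) (n : nat) (a b : \bar R)
    (A : R -> 'M[R]_n) (Phi : R -> R -> 'M[R]_n) :=
  forall t0 : R, oitv a b t0 -> ode_solution a b A t0 (Phi^~ t0).

Definition totally_nonnegative (R : realType) (n : nat) (M : 'M[R]_n) :=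
  forall (k : nat) (f g : 'I_k -> 'I_n),
    {homo f : i j / (i < j)%N} -> {homo g : i j / (i < j)%N} ->
    0 <= \det (mxsub f g M).

(* When A is measurable and locally essentially bounded, the transition matrix
   exists and its values on (a, b) x (a, b) are unique, so the existential
   quantifier merely names it. *)
Definition TNDS (R : realType) (n : nat) (a b : \bar R) (A : R -> 'M[R]_n) :=
  exists Phi : R -> R -> 'M[R]_n,
    transition_matrix a b A Phi /\
    forall t0 t : R, oitv a b t0 -> oitv a b t -> t0 <= t ->
      totally_nonnegative (Phi t t0).

Definition tridiag_nneg_offdiag {R : realType} {n : nat} : set 'M[R]_n :=
  [set M | (forall i j : 'I_n, (i.+1 < j)%N || (j.+1 < i)%N -> M i j = 0) /\
           (forall i j : 'I_n, (j == i.+1 :> nat) || (i == j.+1 :> nat) ->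
              0 <= M i j)].

(* Main.v *)
(* Both directions rest on one fact: an absolutely continuous function whose
   derivative is nonnegative almost everywhere is nondecreasing. It yields a
   Gronwall estimate in the weight ch M t0 t = 2 cosh (M (t - t0)), in which the
   Picard map halves distances on a whole compact interval; hence existence and
   uniqueness of solutions, and the cocycle identity for the transition matrix.

   If A(t) is in M for almost every t, adding a multiple of I to A makes its
   diagonal nonnegative and multiplies the minors by positive factors. A minor
   of the solution then has as derivative a combination, with nonnegative
   coefficients, of minors in which one row index has moved to a neighbour: the
   minors form a cooperative system with nonnegative initial values.

   Conversely, for fixed t0 and almost every t, the curve
   s |-> Phi(s, t0) Phi(t0, t) = Phi(s, t) is I at s = t, has derivative A(t)
   there and is TN for s >= t. Its entries give A(t)_ij >= 0 for i <> j, and its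
   minors Phi_ik Phi_kj - Phi_ij Phi_kk with k strictly between i and j give
   A(t)_ij <= 0. *)
Require Import Defs.
From mathcomp Require Import all_boot all_order all_algebra all_fingroup.
From mathcomp Require Import all_classical all_reals all_analysis.
From mathcomp Require Import measurable_realfun ring lra zify.

Set Implicit Arguments.
Unset Strict Implicit.
Unset Printing Implicit Defensive.

Import Order.TTheory GRing.Theory Num.Theory.
Import numFieldNormedType.Exports.

Local Open Scope classical_set_scope.
Local Open Scope ring_scope.

(** * Monotonicity from almost everywhere derivatives *)

Section MonotoneAC.
Context {R : realType}.
Implicit Types (c d e u v w x y : R) (f g : R -> R) (l : seq (R * R)).

(** Cousin's lemma as an induction on intervals. The supremum of the [s] in [[c, d]] with [P c s]
    cannot lie below [d], because the local hypothesis at the supremum carries [P] past it. *)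
Lemma cousin c d (P : R -> R -> Prop) : c <= d ->
  (forall x, c <= x <= d -> exists2 e, 0 < e &
     forall u v, c <= u -> u <= x -> x <= v -> v <= d -> v - u < e -> P u v) ->
  (forall u v w, u <= v -> v <= w -> P u v -> P v w -> P u w) ->
  P c d.
Proof.
move=> cd loc add.
pose S := [set s | c <= s <= d /\ P c s].
have Sc : S c.
  split; first by rewrite lexx cd.
  have [|e e0 h] := loc c; first by rewrite lexx cd.
  by apply: h; rewrite ?lexx ?subrr.
have ubS : ubound S d by move=> s [/andP[]].
have hS : has_sup S by split; [exists c | exists d].
have cs : c <= sup S by exact: sup_upper_bound.
have sd : sup S <= d by apply: ge_sup => //; exists c.
have [|e e0 h] := loc (sup S); first by rewrite cs sd.
have e2 : 0 < e / 2 by rewrite divr_gt0.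
have [s [/andP[cs' sd'] Ps] sS] := sup_adherent e2 hS.
have ssup : s <= sup S by apply: sup_upper_bound => //; split; rewrite ?cs' ?sd'.
pose v := Num.min d (sup S + e / 2).
have supv : sup S <= v by rewrite le_min sd lerDl ltW.
have Pv : P c v.
  apply: (add c s v) => //; first exact: le_trans supv.
  apply: h => //; first by rewrite ge_min lexx.
  have : v <= sup S + e / 2 by rewrite ge_min lexx orbT.
  lra.
have Sv : S v by split => //; rewrite (le_trans cs)//= ge_min lexx.
have vsup : v <= sup S by exact: sup_upper_bound.
move: Pv; rewrite /v; case: leP => // lt _; exfalso.
by move: vsup; rewrite /v (min_r (ltW lt)); lra.
Qed.

(** Ordered lists of non-overlapping intervals concatenate, so they follow the subdivisions of
    [cousin]; [abs_continuous_chain] turns them into the indexed families of [abs_continuous]. *)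
Fixpoint chain l u v : Prop :=
  if l is pq :: l' then [/\ u <= pq.1, pq.1 <= pq.2 & chain l' pq.2 v]
  else u <= v.

Lemma chain_le l u v : chain l u v -> u <= v.
Proof.
elim: l u => [//|[p q] l ih] u /= [up pq /ih qv].
exact: le_trans up (le_trans pq qv).
Qed.

Lemma chain_lel l u u' v : u' <= u -> chain l u v -> chain l u' v.
Proof.
case: l => [|[p q] l] /= u'u; first exact: le_trans.
by case=> up pq qv; split => //; exact: le_trans up.
Qed.

Lemma chain_cat l1 l2 u v w :
  chain l1 u v -> chain l2 v w -> chain (l1 ++ l2) u w.
Proof.
elim: l1 u => [|[p q] l ih] u /=; first exact: chain_lel.
by case=> up pq qv vw; split => //; exact: ih.
Qed.

Lemma chain_nth l u v i : chain l u v -> (i < size l)%N ->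
  [/\ u <= (nth 0 l i).1, (nth 0 l i).1 <= (nth 0 l i).2 & (nth 0 l i).2 <= v].
Proof.
elim: l u i => [//|[p q] l ih] u [|i] /= [up pq ch] il.
  by split => //; exact: chain_le ch.
have [h1 h2 h3] := ih q i ch il.
by split => //; apply: le_trans h1; exact: le_trans pq.
Qed.

Lemma chain_disj l u v i j : chain l u v -> (i < j < size l)%N ->
  (nth 0 l i).2 <= (nth 0 l j).1.
Proof.
elim: l u i j => [|[p q] l ih] u i j /=; first by rewrite andbF.
case=> up pq ch; case: i j => [|i] [|j] //= ij.
- by have [] := chain_nth ch ij.
- exact: ih ch ij.
Qed.

Lemma abs_continuous_chain c d f e : abs_continuous c d f -> 0 < e ->
  exists2 delta : R, 0 < delta &
  forall l, chain l c d -> \sum_(z <- l) (z.2 - z.1) < delta ->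
    \sum_(z <- l) `|f z.2 - f z.1| < e.
Proof.
move=> acf e0; have [delta delta0 h] := acf e e0.
exists delta => // l ch.
rewrite (big_nth 0) big_mkord => hs; rewrite (big_nth 0) big_mkord.
apply: (h (size l) (fun i => (nth 0 l i).1) (fun i => (nth 0 l i).2)) => //.
  by move=> i; have [] := chain_nth ch (ltn_ord i).
have aux : forall i j : 'I_(size l), (i < j)%N -> forall x,
    (nth 0 l i).1 < x < (nth 0 l i).2 -> (nth 0 l j).1 < x < (nth 0 l j).2 ->
    False.
  move=> i j ij x /andP[_ x1] /andP[x2 _].
  have := @chain_disj l c d i j ch; rewrite ij ltn_ord => /(_ isT).
  by rewrite leNgt (lt_trans x2 x1).
move=> i j _ _ [x [xi xj]]; apply: val_inj => /=.
by case: (ltngtP i j) => // ij; exfalso; [apply: (aux i j)|apply: (aux j i)];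
  eauto.
Qed.

Lemma is_derive_approx f x D e : is_derive x 1 f D -> 0 < e ->
  exists2 delta : R, 0 < delta &
  forall y, `|y - x| < delta -> `|f y - f x - D * (y - x)| <= e * `|y - x|.
Proof.
move=> [df fD] e0.
have : (fun h : R => h^-1 *: ((f \o shift x) (h *: 1) - f x)) @ 0^' --> D.
  by rewrite -fD; exact: df.
move/cvgrPdist_le => /(_ e e0) [delta /= delta0 h].
exists delta => // y yx.
have [->|neq] := eqVneq y x; first by rewrite !subrr !mulr0 subrr normr0 mulr0.
have yx0 : y - x != 0 by rewrite subr_eq0.
have /= := h (y - x); rewrite sub0r normrN => /(_ yx yx0).
rewrite [(y - x) *: 1]mulr1 subrK => he.
rewrite -ler_pdivrMr ?normr_gt0// -normfV -normrM -normrN.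
apply: le_trans he; rewrite le_eqVlt; apply/orP; left; apply/eqP; congr `|_|.
rewrite /GRing.scale /=.
by rewrite mulrBl mulfK// opprB mulrC.
Qed.

Lemma lebesgue_measure_co u v : u <= v ->
  @lebesgue_measure R `[u, v[%classic = (v - u)%:E.
Proof.
move=> uv; rewrite lebesgue_measure_itv/= lte_fin.
have [//|] := ltP u v.
by move=> vu; rewrite (@le_anti _ _ u v) ?uv// subrr.
Qed.

(* A Cousin partition splits [c, d] into pieces tagged by points where the
   derivative exists, which almost do not decrease f, and pieces that together
   lie in an open set of small measure, on which f varies little. *)
Lemma ae_derive_ge0_le c d f : c <= d -> abs_continuous c d f ->
  {ae @lebesgue_measure R, forall x, c < x < d ->
     exists2 D, 0 <= D & is_derive x 1 f D} ->
  f c <= f d.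
Proof.
move=> cd acf [N [mN N0 hN]].
have hN' x : ~ N x -> c < x < d -> exists2 D, 0 <= D & is_derive x 1 f D.
  by move=> Nx; apply: contrapT => nh; apply: Nx; apply: hN.
(* The endpoints join the exceptional set, since the derivative is given in the interior only. *)
pose B := N `|` [set c; d].
have mcd : measurable ([set c; d] : set (measurableTypeR R)).
  by apply: measurableU; exact: measurable_set1.
have mB : measurable (B : set (measurableTypeR R)) by exact: measurableU.
have B0 : lebesgue_measure (B : set R) = 0%E.
  rewrite /B measureU0//.
  have /= := @lebesgue_measure_set1 R; move=> hs.
  apply/eqP; rewrite -measure_le0.
  apply: le_trans (measureU2 _ _ _) _ => //.
  by rewrite [X in (X + _ <= _)%E]hs [X in (_ + X <= _)%E]hs adde0.
apply/ler_addgt0Pr => e' e'0.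
(* The loss [e'] is shared out: [e] per unit of length on the pieces tagged by a derivative, and [e]
   in all on the exceptional pieces. *)
pose e := e' / (d - c + 1).
have dc0 : 0 <= d - c by rewrite subr_ge0.
have e0 : 0 < e by rewrite divr_gt0// ltr_wpDl.
have ee' : e' = e * (d - c) + e.
  rewrite -{2}[e]mulr1 -mulrDr /e mulfVK// gt_eqF// ltr_wpDl//.
have [delta delta0 hdelta] := abs_continuous_chain acf e0.
have [|U [oU BU]] := @lebesgue_regularity_outer R B delta mB _ delta0.
  by rewrite [X in (X < _)%E]B0 ltry.
have mU : measurable (U : set (measurableTypeR R)) by exact: open_measurable.
move=> UBdelta.
have Udelta : (lebesgue_measure U < delta%:E)%E.
  apply: le_lt_trans UBdelta; rewrite -{1}(setDUK BU) setUC.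
  apply: le_trans (measureU2 _ _ _) _ => //; first exact: measurableD.
  by rewrite [X in (_ + X <= _)%E]B0 adde0.
(* The list [l] collects the exceptional pieces between [u] and [v]. Half-open intervals that share
   an endpoint are disjoint, so the measure bounds add up. *)
pose P u v := c <= u -> v <= d -> exists l,
  [/\ chain l u v,
      ((\sum_(z <- l) (z.2 - z.1))%:E <= lebesgue_measure (U `&` `[u, v[))%E &
      - (e * (v - u)) - \sum_(z <- l) `|f z.2 - f z.1| <= f v - f u].
have : P c d.
  apply: cousin => //.
    move=> x /andP[cx xd].
    have [Bx|nBx] := pselect (B x).
      have /nbhs_ballP[r r0 hr] := open_nbhs_nbhs (conj oU (BU _ Bx)).
      exists r => // u v cu ux xv vd uvr _ _.
      exists [:: (u, v)]; split => /=.
      - by split => //; exact: le_trans xv.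
      - rewrite big_seq1/= setIidr.
          by rewrite lebesgue_measure_co//; exact: le_trans xv.
        move=> y /=; rewrite in_itv/= => /andP[uy yv].
        apply: hr; rewrite /ball/= ltr_norml; apply/andP; split; lra.
      - rewrite big_seq1/=.
        have := ler_norm (f u - f v); rewrite distrC.
        have : 0 <= e * (v - u) by rewrite mulr_ge0 ?subr_ge0 ?(le_trans ux)// ltW.
        lra.
    have [|D D0 dfx] := hN' x (fun nx => nBx (or_introl nx)).
      rewrite !lt_neqAle cx xd !andbT; apply/andP; split; apply/eqP => E; apply: nBx.
        by right; left.
      by right; right.
    (* No exceptional piece is needed here: the first-order expansion at the tag [x], which lies
       between [u] and [v], is applied at both ends. *)
    have [r r0 hr] := is_derive_approx dfx e0.
    exists r => // u v cu ux xv vd uvr _ _.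
    exists [::]; rewrite !big_nil; split => //=; first exact: le_trans xv.
    have /hr : `|u - x| < r by rewrite ltr_norml; apply/andP; split; lra.
    have /hr : `|v - x| < r by rewrite ltr_norml; apply/andP; split; lra.
    rewrite (ger0_norm (_ : 0 <= v - x)) ?subr_ge0//.
    rewrite (ler0_norm (_ : u - x <= 0)) ?subr_le0//.
    rewrite !ler_norml => /andP[h1 _] /andP[_ h2].
    have : 0 <= D * (v - x) by rewrite mulr_ge0// subr_ge0.
    have : 0 <= D * (x - u) by rewrite mulr_ge0// subr_ge0.
    lra.
  move=> u v w uv vw Puv Pvw cu wd.
  have [l1 [ch1 m1 i1]] := Puv cu (le_trans vw wd).
  have [l2 [ch2 m2 i2]] := Pvw (le_trans cu uv) wd.
  exists (l1 ++ l2); rewrite !big_cat/=; split; first exact: chain_cat ch1 ch2.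
    rewrite EFinD; apply: le_trans (leeD m1 m2) _.
    rewrite -measureU//=; last 3 first.
    - by apply: measurableI => //; exact: measurable_itv.
    - by apply: measurableI => //; exact: measurable_itv.
    - apply/seteqP; split => // x [[_ /=]]; rewrite in_itv/= => /andP[_ xv] [_ /=].
      by rewrite in_itv/= leNgt xv.
    rewrite le_measure ?inE//.
    - by apply: measurableU; apply: measurableI => //; exact: measurable_itv.
    - by apply: measurableI => //; exact: measurable_itv.
    - move=> x [] [Ux /=]; rewrite in_itv/= => /andP[h1 h2];
        (split=> //; rewrite /= in_itv/=; apply/andP; split) => //.
        exact: lt_le_trans vw.
      exact: le_trans h1.
  lra.
move=> /(_ (lexx _) (lexx _)) [l [ch m i]].
have : \sum_(z <- l) `|f z.2 - f z.1| < e.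
  apply: hdelta => //; rewrite -lte_fin; apply: le_lt_trans m _.
  apply: le_lt_trans Udelta; rewrite le_measure ?inE//.
  by apply: measurableI => //; exact: measurable_itv.
by move: i; rewrite ee'; lra.
Qed.

End MonotoneAC.

(** * Comparison of absolutely continuous functions *)

Section Comparison.
Context {R : realType}.
Implicit Types (c d e u v w x y : R) (f g : R -> R).

Lemma aeS (P Q : R -> Prop) : {ae @lebesgue_measure R, forall x, P x} ->
  (forall x, P x -> Q x) -> {ae @lebesgue_measure R, forall x, Q x}.
Proof.
by move=> h PQ; apply: negligibleS h => x /= nQ Px; apply: nQ; exact: PQ.
Qed.

Lemma ae_and (P Q : R -> Prop) : {ae @lebesgue_measure R, forall x, P x} ->
  {ae @lebesgue_measure R, forall x, Q x} ->
  {ae @lebesgue_measure R, forall x, P x /\ Q x}.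
Proof.
move=> hP hQ; apply: negligibleS (negligibleU hP hQ) => x /= /not_andP[]; by [left|right].
Qed.

Lemma ae_countable (I : countType) (P : I -> R -> Prop) :
  (forall i, {ae @lebesgue_measure R, forall x, P i x}) ->
  {ae @lebesgue_measure R, forall x, forall i, P i x}.
Proof.
move=> h.
pose F k := if unpickle k is Some i then ~` [set x | P i x] else set0.
have : (@lebesgue_measure R).-negligible (\bigcup_k F k).
  apply: negligible_bigcup => k; rewrite /F.
  by case: unpickle => [i|]; [exact: h|exact: negligible_set0].
apply: negligibleS => x /= /existsNP[i nP].
by exists (pickle i) => //; rewrite /F pickleK.
Qed.

(** Solutions are Lipschitz on compact intervals ([linear_ode_lip]). Lipschitz bounds pass easily
    through the products in a determinant, and [lip_abs_continuous] leads back to absolute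
    continuity. *)
Definition lip (V : normedModType R) c d (f : R -> V) := exists2 K, 0 <= K &
  forall x y, c <= x -> x <= y -> y <= d -> `|f y - f x| <= K * (y - x).

Lemma abs_continuousS (V : normedModType R) c d c' d' (f : R -> V) :
  c <= c' -> d' <= d ->
  abs_continuous c d f -> abs_continuous c' d' f.
Proof.
move=> cc dd acf e e0; have [delta delta0 h] := acf e e0.
exists delta => // m u v uv; apply: h => i; have [h1 h2 h3] := uv i.
by split => //; [exact: le_trans h1|exact: le_trans dd].
Qed.

Lemma abs_continuousN c d f :
  abs_continuous c d f -> abs_continuous c d (fun x => - f x).
Proof.
move=> acf e /acf[delta delta0 h]; exists delta => // m u v uv tr s.
by under eq_bigr do rewrite -opprD normrN; exact: h.
Qed.

Lemma abs_continuousD c d f g : abs_continuous c d f -> abs_continuous c d g ->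
  abs_continuous c d (fun x => f x + g x).
Proof.
move=> acf acg e e0; have e2 : 0 < e / 2 by rewrite divr_gt0.
have [r r0 hr] := acf _ e2; have [s s0 hs] := acg _ e2.
exists (Num.min r s); first by rewrite lt_min r0 s0.
move=> m u v uv tr; rewrite lt_min => /andP[/hr - /(_ uv tr) h1 /hs - /(_ uv tr) h2].
rewrite (splitr e); apply: le_lt_trans (ltrD h1 h2).
by rewrite -big_split/=; apply: ler_sum => i _; rewrite opprD addrACA ler_normD.
Qed.

Lemma lip_abs_continuous (V : normedModType R) c d (f : R -> V) :
  lip c d f -> abs_continuous c d f.
Proof.
move=> [K K0 hK] e e0; have K1 : 0 < K + 1 by rewrite ltr_wpDl.
exists (e / (K + 1)); first by rewrite divr_gt0.
move=> m u v uv _; rewrite ltr_pdivlMr// => h.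
apply: le_lt_trans h; rewrite mulr_suml; apply: ler_sum => i _.
have [h1 h2 h3] := uv i; apply: le_trans (hK _ _ h1 h2 h3) _.
by rewrite mulrC ler_wpM2l ?subr_ge0// lerDl.
Qed.

(** Absolute continuity with tolerance 1 bounds the oscillation on short intervals, and [cousin]
    adds these bounds up. *)
Lemma abs_continuous_bounded c d f : c <= d -> abs_continuous c d f ->
  exists2 B, 0 <= B & forall x, c <= x -> x <= d -> `|f x| <= B.
Proof.
move=> cd acf; have [r r0 hr] := abs_continuous_chain acf ltr01.
pose P u v := c <= u -> v <= d ->
  exists B, forall x, u <= x -> x <= v -> `|f x - f u| <= B.
have : P c d.
  apply: cousin => // [x xcd|u v w uv vw Puv Pvw cu wd].
    exists r => // u v cu ux xv vd uvr _ _; exists 1 => y uy yv.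
    have := hr [:: (u, y)]; rewrite !big_seq1/= => /(_ _ _)/ltW; apply.
      by split => //; exact: le_trans vd.
    lra.
  have [B1 h1] := Puv cu (le_trans vw wd).
  have [B2 h2] := Pvw (le_trans cu uv) wd.
  have B1' : 0 <= B1 by apply: le_trans (h1 _ (lexx _) uv).
  have B2' : 0 <= B2 by apply: le_trans (h2 _ (lexx _) vw).
  exists (B1 + B2) => x ux xw; have [xv|/ltW vx] := leP x v.
    by apply: le_trans (h1 _ ux xv) _; rewrite lerDl.
  rewrite -(subrKA (f v)) addrC; apply: le_trans (ler_normD _ _) _.
  by rewrite lerD ?h1 ?h2.
move=> /(_ (lexx _) (lexx _))[B hB]; exists (B + `|f c|).
  by rewrite addr_ge0//; apply: le_trans (hB _ (lexx _) cd).
move=> x cx xd; rewrite -(subrK (f c) (f x)); apply: le_trans (ler_normD _ _) _.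
by rewrite lerD2r hB.
Qed.

Lemma lip_bounded c d f : c <= d -> lip c d f ->
  exists2 B, 0 <= B & forall x, c <= x -> x <= d -> `|f x| <= B.
Proof. by move=> cd /lip_abs_continuous; exact: abs_continuous_bounded. Qed.

Lemma lip_cst c d (k : R) : lip c d (fun=> k).
Proof. by exists 0 => // x y _ _ _; rewrite subrr normr0 mul0r. Qed.

Lemma lipD c d f g : lip c d f -> lip c d g -> lip c d (fun x => f x + g x).
Proof.
move=> [K K0 hK] [L L0 hL]; exists (K + L); first by rewrite addr_ge0.
move=> x y cx xy yd; rewrite opprD addrACA mulrDl.
by apply: le_trans (ler_normD _ _) _; rewrite lerD ?hK ?hL.
Qed.

Lemma lipM c d f g : c <= d -> lip c d f -> lip c d g ->
  lip c d (fun x => f x * g x).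
Proof.
move=> cd lf lg; have [B B0 hB] := lip_bounded cd lf.
have [B' B'0 hB'] := lip_bounded cd lg.
move: lf lg => [K K0 hK] [L L0 hL].
exists (B * L + B' * K); first by rewrite addr_ge0// mulr_ge0.
move=> x y cx xy yd.
have -> : f y * g y - f x * g x = f y * (g y - g x) + g x * (f y - f x) by ring.
rewrite mulrDl -!mulrA; apply: le_trans (ler_normD _ _) _; rewrite !normrM.
rewrite lerD// ler_pM//; [apply: hB|exact: hL|apply: hB'|exact: hK] => //.
  exact: le_trans xy.
exact: le_trans yd.
Qed.

Lemma lip_sum c d (I : Type) (s : seq I) (P : pred I) (h : I -> R -> R) :
  (forall i, lip c d (h i)) -> lip c d (fun x => \sum_(i <- s | P i) h i x).
Proof.
move=> hl; elim: s => [|i s ih].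
  by under eq_fun do rewrite big_nil; exact: lip_cst.
under eq_fun do rewrite big_cons.
by case: (P i) => //; exact: lipD.
Qed.

Lemma lip_prod c d (I : Type) (s : seq I) (P : pred I) (h : I -> R -> R) :
  c <= d ->
  (forall i, lip c d (h i)) -> lip c d (fun x => \prod_(i <- s | P i) h i x).
Proof.
move=> cd hl; elim: s => [|i s ih].
  by under eq_fun do rewrite big_nil; exact: lip_cst.
under eq_fun do rewrite big_cons.
by case: (P i) => //; exact: lipM.
Qed.

Lemma lip_linear c d (k t0 : R) : lip c d (fun x => k * (x - t0)).
Proof.
exists `|k| => // x y cx xy yd.
have -> : k * (y - t0) - k * (x - t0) = k * (y - x) by ring.
by rewrite normrM (ger0_norm (_ : 0 <= y - x)) ?subr_ge0.
Qed.

Lemma lip_expR c d (k t0 : R) : lip c d (fun x => expR (k * (x - t0))).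
Proof.
pose m := `|k| * (`|c - t0| + `|d - t0|).
have bnd x : c <= x -> x <= d -> expR (k * (x - t0)) <= expR m.
  move=> cx xd; rewrite ler_expR; apply: le_trans (ler_norm _) _.
  rewrite normrM ler_wpM2l//.
  have := ler_norm (d - t0); have := ler_norm (t0 - c); rewrite distrC.
  have := normr_ge0 (d - t0); have := normr_ge0 (c - t0).
  by rewrite ler_norml => *; apply/andP; split; lra.
(* This is [1 + x <= expR x] at [x = b - a], multiplied by [expR a]; it stands in for the mean value
   theorem. *)
have aux (a b : R) : expR a - expR b <= expR a * (a - b).
  have := expR_ge1Dx (b - a); rewrite expRD expRN -(ler_pM2l (expR_gt0 a)).
  by rewrite (mulrCA (expR a)) mulfV ?mulr1 ?gt_eqF ?expR_gt0//; lra.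
exists (expR m * `|k|); first by rewrite mulr_ge0// expR_ge0.
move=> x y cx xy yd.
have xd := le_trans xy yd; have cy := le_trans cx xy.
have E (s : R) : s = k * (y - x) \/ s = k * (x - y) -> s <= `|k| * (y - x).
  have yx0 : 0 <= y - x by rewrite subr_ge0.
  by rewrite -{2}(ger0_norm yx0) -normrM => -[->|->];
     [exact: ler_norm|rewrite -(opprB y x) mulrN -normrN ler_norm].
have B2 (s : R) x' : c <= x' -> x' <= d -> s = k * (y - x) \/ s = k * (x - y) ->
    expR (k * (x' - t0)) * s <= expR m * `|k| * (y - x).
  move=> h1 h2 hs; apply: le_trans (_ : expR (k * (x' - t0)) * (`|k| * (y - x)) <= _).
    by rewrite ler_wpM2l ?expR_ge0// E.
  by rewrite -mulrA ler_wpM2r ?bnd// mulr_ge0// subr_ge0.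
rewrite ler_norml lerNl opprB; apply/andP; split.
  by apply: le_trans (aux _ _) _; apply: B2 => //; right; ring.
by apply: le_trans (aux _ _) _; apply: B2 => //; left; ring.
Qed.

(** A mean value inequality: both [g + f] and [g - f] have a nonnegative derivative almost
    everywhere, hence do not decrease. *)
Lemma ae_derive_le c d f g : c <= d ->
  abs_continuous c d f -> abs_continuous c d g ->
  {ae @lebesgue_measure R, forall x, c < x < d ->
     exists D E, [/\ `|D| <= E, is_derive x 1 f D & is_derive x 1 g E]} ->
  `|f d - f c| <= g d - g c.
Proof.
move=> cd acf acg hae.
have h1 : g c + f c <= g d + f d.
  apply: (@ae_derive_ge0_le _ c d (fun x => g x + f x)) => //.
    exact: abs_continuousD.
  apply: (aeS hae) => x /[apply] -[D [E [DE fD gE]]].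
  exists (E + D); last exact: is_deriveD.
  by move: DE; rewrite ler_norml => /andP[]; lra.
have h2 : g c - f c <= g d - f d.
  apply: (@ae_derive_ge0_le _ c d (fun x => g x - f x)) => //.
    by apply: abs_continuousD => //; exact: abs_continuousN.
  apply: (aeS hae) => x /[apply] -[D [E [DE fD gE]]].
  exists (E - D); last exact: is_deriveB.
  by move: DE; rewrite ler_norml => /andP[]; lra.
by rewrite ler_norml; apply/andP; split; lra.
Qed.

Lemma is_derive_expR_linear (k t0 x : R) :
  is_derive x 1 (fun y => expR (k * (y - t0))) (k * expR (k * (x - t0))).
Proof.
by apply: is_derive_eq; rewrite /GRing.scale/=; ring.
Qed.

(** Being even about [t0], the weight [ch] serves both directions of time at once. [sh] is twice the
    hyperbolic sine: it vanishes at [t0], has derivative [M * ch], and is at most [ch] in absolute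
    value. *)
Definition ch (M t0 t : R) := expR (M * (t - t0)) + expR (- M * (t - t0)).
Definition sh (M t0 t : R) := expR (M * (t - t0)) - expR (- M * (t - t0)).

Lemma ch_ge1 (M t0 t : R) : 1 <= ch M t0 t.
Proof.
rewrite /ch; have [h|h] := leP 0 (M * (t - t0)).
  have := expR_ge1Dx (M * (t - t0)); have := expR_ge0 (- M * (t - t0)); lra.
have := expR_ge1Dx (- M * (t - t0)); have := expR_ge0 (M * (t - t0)).
by rewrite mulNr; lra.
Qed.

Lemma sh0 (M t0 : R) : sh M t0 t0 = 0.
Proof. by rewrite /sh subrr !mulr0 subrr. Qed.

Lemma lip_sh c d (C M t0 : R) : c <= d -> lip c d (fun x => C * sh M t0 x).
Proof.
move=> cd; apply: lipM => //; first exact: lip_cst.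
apply: lipD; first exact: lip_expR.
have := lipM cd (lip_cst c d (-1)) (lip_expR c d (- M) t0).
by under eq_fun do rewrite mulN1r.
Qed.

Lemma is_derive_sh (C M t0 x : R) :
  is_derive x 1 (fun y => C * sh M t0 y) (C * (M * ch M t0 x)).
Proof.
have d1 := is_derive_expR_linear M t0 x.
have d2 := is_derive_expR_linear (- M) t0 x.
have := is_deriveZ C (is_deriveB d1 d2).
by rewrite mulNr opprK -mulrDr; exact.
Qed.

Lemma geometric_small (C e : R) : 0 < e -> exists k : nat, C / 2 ^+ k <= e.
Proof.
move=> e0; exists (Num.truncn (C / e)).+1.
rewrite ler_pdivrMr ?exprn_gt0// -ler_pdivrMl// mulrC ltW//.
apply: lt_trans (truncnS_gt _) _.
by rewrite -natrX ltr_nat ltn_expl.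
Qed.

(** The bound on the derivative of [f] is the derivative of [C * sh]. Comparison from [t0], to the
    left or to the right, gives [C * |sh|], which [C * ch] dominates. *)
Lemma gronwall_step c d t0 (C M : R) f : 0 <= C -> c <= t0 -> t0 <= d ->
  abs_continuous c d f -> f t0 = 0 ->
  {ae @lebesgue_measure R, forall x, c < x < d ->
     exists2 D, `|D| <= C * (M * ch M t0 x) & is_derive x 1 f D} ->
  forall t, c <= t -> t <= d -> `|f t| <= C * ch M t0 t.
Proof.
move=> C0 ct0 t0d acf f0 hae.
have step u v : c <= u -> u <= v -> v <= d ->
    `|f v - f u| <= C * sh M t0 v - C * sh M t0 u.
  move=> cu uv vd; apply: (@ae_derive_le u v f (fun x => C * sh M t0 x)) => //.
  - exact: abs_continuousS acf.
  - exact/lip_abs_continuous/lip_sh.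
  - apply: (aeS hae) => x hx /andP[ux xv].
    have [|D DC fD] := hx.
      by rewrite (le_lt_trans cu)//=; exact: lt_le_trans vd.
    by exists D, (C * (M * ch M t0 x)); split => //; exact: is_derive_sh.
move=> t ct td; rewrite /ch.
have := expR_ge0 (M * (t - t0)); have := expR_ge0 (- M * (t - t0)) => p1 p2.
have [tt0|/ltW tt0] := leP t t0.
  have := step t t0 ct tt0 t0d; rewrite f0 sh0 mulr0 sub0r normrN sub0r.
  move/le_trans; apply; rewrite -mulrN ler_wpM2l// /sh; lra.
have := step t0 t ct0 tt0 td; rewrite f0 sh0 mulr0 subr0 subr0.
by move/le_trans; apply; rewrite ler_wpM2l// /sh; lra.
Qed.

End Comparison.

(** * Linear differential equations *)

Section LinearODE.
Context {R : realType} {n : nat}.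
Implicit Types (c d t : R) (A F G : R -> 'M[R]_n).

Lemma mx_entry_norm_le (M : 'M[R]_n) i j : `|M i j| <= `|M|.
Proof.
rewrite [leRHS]/Num.Def.normr/= mx_normrE.
exact: (le_bigmax _ (fun ij => `|M ij.1 ij.2|) (i, j)).
Qed.

Lemma is_derive_mxP t F (D : 'M[R]_n) : is_derive t 1 F D <->
  forall i j, is_derive t 1 (fun s => F s i j) (D i j).
Proof.
split=> [[dF <-] i j|h].
  split; first by move/derivable_mxP: dF; exact.
  by rewrite derive_mx// mxE.
have dF : derivable F t 1 by apply/derivable_mxP => i j; have [] := h i j.
split=> //; rewrite derive_mx//; apply/matrixP => i j; rewrite mxE.
by have [] := h i j.
Qed.

Lemma mulmx_entry_le (M N : 'M[R]_n) (K B : R) i j :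
  (forall i j, `|M i j| <= K) -> (forall i j, `|N i j| <= B) ->
  `|(M *m N) i j| <= n%:R * K * B.
Proof.
move=> hM hN; rewrite mxE; apply: le_trans (ler_norm_sum _ _ _) _.
have -> : n%:R * K * B = \sum_(l < n) K * B.
  by rewrite sumr_const card_ord mulr_natl mulrnAl.
by apply: ler_sum => l _; rewrite normrM ler_pM.
Qed.

(** Up to the initial value, [G] is the Picard image of [F]. Keeping the two apart lets one relation
    describe both the iterates and, in [linear_ode], the fixed points. Working entrywise keeps the
    analysis scalar. *)
Definition ae_primitive c d A F G := {ae @lebesgue_measure R,
  forall x, c < x < d ->
    forall i j, is_derive x 1 (fun t => G t i j) ((A x *m F x) i j)}.

Definition linear_ode c d A F :=
  (forall i j, abs_continuous c d (fun t => F t i j)) /\ ae_primitive c d A F F.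

Definition ess_bounded_by c d A (K : R) := {ae @lebesgue_measure R,
  forall x, c < x < d -> forall i j, `|A x i j| <= K}.

Lemma mx_abs_continuous_bounded c d F : c <= d ->
  (forall i j, abs_continuous c d (fun t => F t i j)) ->
  exists2 B, 0 <= B & forall x, c <= x -> x <= d -> forall i j, `|F x i j| <= B.
Proof.
move=> cd acF.
have /(_ _)/cid2-/all_sig2[B B0 hB] := fun ij : 'I_n * 'I_n =>
  abs_continuous_bounded cd (acF ij.1 ij.2).
exists (\sum_ij B ij); first by apply: sumr_ge0.
move=> x cx xd i j; apply: le_trans (hB (i, j) x cx xd) _.
by rewrite (bigD1 (i, j))//= lerDl sumr_ge0.
Qed.

(** [F] is bounded on [[c, d]], so the entries of [A *m F] are essentially bounded there; comparison
    with a linear function concludes. *)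
Lemma linear_ode_lip c d A F K : c <= d -> linear_ode c d A F ->
  ess_bounded_by c d A K -> forall i j, lip c d (fun t => F t i j).
Proof.
move=> cd lF bA i j; have [acF dF] := lF.
have [B B0 hB] := mx_abs_continuous_bounded cd acF.
pose L := n%:R * `|K| * B; exists L; first by rewrite !mulr_ge0.
move=> x y cx xy yd; rewrite mulrBr.
have -> : L * y - L * x = L * (y - 0) - L * (x - 0) by rewrite !subr0.
apply: (@ae_derive_le _ x y (fun t => F t i j) (fun t => L * (t - 0))) => //.
- exact: abs_continuousS (acF i j).
- exact/lip_abs_continuous/lip_linear.
- apply: (aeS (ae_and dF bA)) => z [h1 h2] /andP[xz zy].
  have cz : c < z by exact: le_lt_trans xz.
  have zd : z < d by exact: lt_le_trans yd.
  exists ((A z *m F z) i j), L; split.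
  + apply: mulmx_entry_le => i' j'; last by rewrite hB// ltW.
    by apply: le_trans (ler_norm K); apply: h2; rewrite cz.
  + by apply: h1; rewrite cz.
  + have -> : (fun t => L * (t - 0)) = L \*: id.
      by apply/funext => t /=; rewrite subr0.
    by rewrite -[X in is_derive _ _ _ X]mulr1; exact: is_deriveZ.
Qed.

(* Measured in the weight ch, the Picard map is a contraction of factor 1/2 on
   the whole of [c, d]. *)
Lemma ae_primitive_contract c d A F F' G G' K C t0 : 0 <= C ->
  ess_bounded_by c d A K -> c <= t0 -> t0 <= d ->
  ae_primitive c d A F G -> ae_primitive c d A F' G' ->
  (forall i j, abs_continuous c d (fun t => G t i j)) ->
  (forall i j, abs_continuous c d (fun t => G' t i j)) -> G t0 = G' t0 ->
  (forall t, c <= t -> t <= d -> forall i j,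
     `|F t i j - F' t i j| <= C * ch (2 * (n%:R * `|K|)) t0 t) ->
  forall t, c <= t -> t <= d -> forall i j,
     `|G t i j - G' t i j| <= C / 2 * ch (2 * (n%:R * `|K|)) t0 t.
Proof.
move=> C0 bA ct0 t0d dG dG' acG acG' GG' FF' t ct td i j.
set L := n%:R * `|K|.
apply: (@gronwall_step _ c d t0 (C / 2) (2 * L) (fun t => G t i j - G' t i j)).
- by rewrite divr_ge0.
- by [].
- by [].
- by apply: abs_continuousD => //; exact: abs_continuousN.
- by rewrite GG' subrr.
- apply: (aeS (ae_and (ae_and dG dG') bA)) => z [[h1 h2] h3] cz.
  exists ((A z *m F z) i j - (A z *m F' z) i j).
    have -> : (A z *m F z) i j - (A z *m F' z) i j = (A z *m (F z - F' z)) i j.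
      by rewrite mulmxBr !mxE.
    (* The weight grows at twice the rate [L] at which [A] can amplify entries; hence the factor
       1/2. *)
    have -> : C / 2 * (2 * L * ch (2 * L) t0 z) = L * (C * ch (2 * L) t0 z).
      by field.
    apply: mulmx_entry_le => i' j'; first by apply: le_trans (ler_norm K); exact: h3.
    by rewrite !mxE; case/andP: cz => *; apply: FF'; exact: ltW.
  by apply: is_deriveB; [exact: h1|exact: h2].
- by [].
- by [].
Qed.

(** A solution is its own Picard image, so the contraction applies repeatedly to the difference of
    two solutions, which is bounded to begin with. *)
Lemma linear_ode_uniq c d A F G K t0 : linear_ode c d A F ->
  linear_ode c d A G -> ess_bounded_by c d A K -> c <= t0 -> t0 <= d ->
  F t0 = G t0 -> forall t, c <= t -> t <= d -> F t = G t.
Proof.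
move=> [acF dF] [acG dG] bA ct0 t0d FG; have cd := le_trans ct0 t0d.
have acFG i j : abs_continuous c d (fun t => (F t - G t) i j).
  have -> : (fun t => (F t - G t) i j) = (fun t => F t i j + - G t i j).
    by apply/funext => t; rewrite !mxE.
  by apply: abs_continuousD => //; exact: abs_continuousN.
have [C C0 hC] := mx_abs_continuous_bounded cd acFG.
pose M := 2 * (n%:R * `|K|).
have bound k : forall t, c <= t -> t <= d -> forall i j,
    `|F t i j - G t i j| <= C / 2 ^+ k * ch M t0 t.
  elim: k => [|k ih].
    move=> t ct td i j; rewrite expr0 divr1.
    have := hC t ct td i j; rewrite !mxE => /le_trans; apply.
    by rewrite ler_peMr// ch_ge1.
  have -> : C / 2 ^+ k.+1 = C / 2 ^+ k / 2 by rewrite exprSr invfM mulrA.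
  apply: (ae_primitive_contract (F := F) (F' := G) _ bA) => //.
  by rewrite divr_ge0// exprn_ge0.
move=> t ct td; apply/matrixP => i j; apply/eqP; rewrite -subr_eq0.
rewrite -normr_le0; apply/ler_addgt0Pr => e e0; rewrite add0r.
have [k hk] := geometric_small (C * ch M t0 t) e0.
by apply: le_trans (bound k t ct td i j) _; rewrite mulrAC.
Qed.

Lemma is_derive_mulmxr F (D X : 'M[R]_n) t :
  (forall i j, is_derive t 1 (fun s => F s i j) (D i j)) ->
  forall i j, is_derive t 1 (fun s => (F s *m X) i j) ((D *m X) i j).
Proof.
move=> h i j; rewrite mxE.
have -> : (fun s => (F s *m X) i j) =
    \sum_(l < n) (fun s => X l j *: F s i l).
  apply/funext => s; rewrite mxE fct_sumE; apply: eq_bigr => l _.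
  by rewrite mulrC.
apply: is_derive_sum => l; rewrite mulrC; exact: is_deriveZ.
Qed.

(** A constant right factor changes the initial value but not the equation; the cocycle identity
    relies on this. *)
Lemma linear_odeMr c d A F (X : 'M[R]_n) : c <= d ->
  linear_ode c d A F -> linear_ode c d A (fun t => F t *m X).
Proof.
move=> cd [acF dF]; split=> [i j|].
  have -> : (fun t => (F t *m X) i j) =
      (fun t => \sum_(l <- index_enum 'I_n) F t i l * X l j).
    by apply/funext => t; rewrite mxE.
  elim: (index_enum _) => [|l s ih].
    have -> : (fun t => \sum_(l <- [::]) F t i l * X l j) = (fun=> 0).
      by apply/funext => t; rewrite big_nil.
    exact/lip_abs_continuous/lip_cst.
  have -> : (fun t => \sum_(l <- l :: s) F t i l * X l j) =
      (fun t => F t i l * X l j + \sum_(l <- s) F t i l * X l j).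
    by apply/funext => t; rewrite big_cons.
  apply: (@abs_continuousD _ c d (fun t => F t i l * X l j)) => //.
  move=> e e0; have e1 : 0 < e / (`|X l j| + 1) by rewrite divr_gt0// ltr_wpDl.
  have [r r0 hr] := acF i l _ e1; exists r => // m u v uv tr /hr - /(_ uv tr).
  rewrite ltr_pdivlMr ?ltr_wpDl// => h; apply: le_lt_trans h.
  rewrite mulr_suml; apply: ler_sum => q _.
  by rewrite -mulrBl normrM ler_wpM2l// lerDl.
apply: (aeS dF) => x h cx i j; rewrite mulmxA.
by apply: is_derive_mulmxr => // *; exact: h.
Qed.

End LinearODE.

(** * Minors *)

Section DeriveDet.
Context {R : realType}.

Lemma is_derive_prod k (h : 'I_k -> R -> R) (dh : 'I_k -> R) (x : R) :
  (forall i, is_derive x 1 (h i) (dh i)) ->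
  is_derive x 1 (fun t => \prod_(i < k) h i t)
    (\sum_(r < k) \prod_(i < k) if i == r then dh i else h i x).
Proof.
elim: k h dh => [|k ih] h dh hd.
  rewrite big_ord0; under eq_fun do rewrite big_ord0.
  exact: is_derive_cst.
have -> : (fun t => \prod_(i < k.+1) h i t) =
    h ord0 * (fun t => \prod_(i < k) h (lift ord0 i) t).
  by apply/funext => t; rewrite big_ord_recl.
have := is_deriveM (hd ord0) (ih _ _ (fun i => hd (lift ord0 i))).
move/is_derive_eq; apply.
rewrite big_ord_recl addrC; congr (_ + _).
  rewrite big_ord_recl eqxx /GRing.scale/= mulrC; congr (_ * _).
rewrite /GRing.scale/= mulr_sumr; apply: eq_bigr => r _.
rewrite big_ord_recl; congr (_ * _).
Qed.

(** The Leibniz expansion is differentiated one factor at a time, and exchanging the sums groups the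
    terms by the differentiated row. *)
Lemma is_derive_det k (m : 'I_k -> 'I_k -> R -> R) (dm : 'I_k -> 'I_k -> R)
    (x : R) :
  (forall i j, is_derive x 1 (m i j) (dm i j)) ->
  is_derive x 1 (fun t => \det (\matrix_(i, j) m i j t))
    (\sum_(r < k) \det (\matrix_(i, j) if i == r then dm i j else m i j x)).
Proof.
move=> h; rewrite exchange_big/=.
have -> : (fun t => \det (\matrix_(i, j) m i j t)) =
    (fun t => \sum_(s : 'S_k) (-1) ^+ s * \prod_i m i (s i) t).
  apply/funext => t; apply: eq_bigr => s _; congr (_ * _).
  by apply: eq_bigr => i _; rewrite mxE.
have sumD (I : Type) (q : seq I) (f : I -> R -> R) (df : I -> R) :
    (forall i, is_derive x 1 (f i) (df i)) ->
    is_derive x 1 (fun t => \sum_(i <- q) f i t) (\sum_(i <- q) df i).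
  move=> hf; elim: q => [|i q ih].
    rewrite big_nil; under eq_fun do rewrite big_nil.
    exact: is_derive_cst.
  rewrite big_cons; under eq_fun do rewrite big_cons.
  exact: is_deriveD.
apply: sumD => s; rewrite -mulr_sumr; apply: is_deriveZ.
have := is_derive_prod (fun i => h i (s i)).
move/is_derive_eq; apply; apply: eq_bigr => r _; apply: eq_bigr => i _.
by rewrite mxE.
Qed.

End DeriveDet.

Section Minors.
Context {R : realType} {n : nat}.
Implicit Types (B G : 'M[R]_n).

Definition upd k (f : 'I_k -> 'I_n) r l : 'I_k -> 'I_n :=
  fun i => if i == r then l else f i.

(** Each row of [B *m G] is a combination of rows of [G], and the determinant is linear in row
    [r]. *)
Lemma det_mulmx_row k (f g : 'I_k -> 'I_n) B G r :
  \det (\matrix_(i, j) if i == r then (B *m G) (f i) (g j) else G (f i) (g j)) =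
  \sum_l B (f r) l * \det (mxsub (upd f r l) g G).
Proof.
under [RHS]eq_bigr do rewrite mulr_sumr.
rewrite exchange_big/=; apply: eq_bigr => s _.
rewrite (bigD1 r)//= !mxE eqxx mulr_suml mulr_sumr; apply: eq_bigr => l _.
rewrite [X in _ = _ * (_ * X)](bigD1 r)//= !mxE /upd eqxx.
rewrite [RHS]mulrCA -!mulrA; congr (_ * (_ * (_ * _))).
by apply: eq_bigr => i /negPf ir; rewrite !mxE ir.
Qed.

(** If the ranges of [f] and [g] differ, the submatrix has a zero row or a zero column. Otherwise
    two increasing enumerations of one set coincide, by induction on the position, and the minor is
    1. *)
Lemma det_mxsub1_ge0 k (f g : 'I_k -> 'I_n) :
  {homo f : i j / (i < j)%N} -> {homo g : i j / (i < j)%N} ->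
  0 <= \det (mxsub f g (1%:M : 'M[R]_n)).
Proof.
move=> hf hg.
have [hr|/existsNP[r hr]] := pselect (forall r, exists j, f r = g j); last first.
  rewrite (expand_det_row _ r) big1// => j _; rewrite !mxE.
  have [E|_] := eqVneq; last by rewrite mul0r.
  by exfalso; apply: hr; exists j.
have [hc|/existsNP[r hc]] := pselect (forall r, exists j, g r = f j); last first.
  rewrite (expand_det_col _ r) big1// => j _; rewrite !mxE.
  have [E|_] := eqVneq; last by rewrite mul0r.
  by exfalso; apply: hc; exists j.
have fg m : forall r : 'I_k, (r < m)%N -> f r = g r.
  elim: m => // m ih r; rewrite ltnS => rm.
  have [j1 e1] := hr r; have [j2 e2] := hc r.
  have h1 : (g r <= f r)%N.
    have [lt|ge] := ltnP j1 r; last first.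
      rewrite e1; have [->//|ne] := eqVneq r j1; apply/ltnW/hg.
      by move: ne; rewrite -(inj_eq val_inj) /=; lia.
    have := hf _ _ lt; rewrite (ih j1); last by lia.
    by rewrite -e1 ltnn.
  have h2 : (f r <= g r)%N.
    have [lt|ge] := ltnP j2 r; last first.
      rewrite e2; have [->//|ne] := eqVneq r j2; apply/ltnW/hf.
      by move: ne; rewrite -(inj_eq val_inj) /=; lia.
    have := hg _ _ lt; rewrite -(ih j2); last by lia.
    by rewrite -e2 ltnn.
  by apply: val_inj; apply/eqP; rewrite eqn_leq h1 h2.
have -> : mxsub f g (1%:M : 'M[R]_n) = 1%:M.
  apply/matrixP => i j; rewrite !mxE (fg i.+1 i)//; congr (nat_of_bool _)%:R.
  have [->|ij] := eqVneq i j; first by rewrite eqxx.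
  apply/eqP => E; move: ij; rewrite neq_ltn => /orP[] /hg; by rewrite E ltnn.
by rewrite det1.
Qed.

(* Moving one row index to a neighbour keeps the indices increasing, unless
   two rows become equal and the minor vanishes. *)
Lemma tridiag_minor_ge k (f g : 'I_k -> 'I_n) B G r l (K eta : R) :
  tridiag_nneg_offdiag B -> (forall i, 0 <= B i i) -> (forall i j, B i j <= K) ->
  0 <= eta -> {homo f : i j / (i < j)%N} ->
  (forall f' : 'I_k -> 'I_n, {homo f' : i j / (i < j)%N} ->
     - eta <= \det (mxsub f' g G)) ->
  - (K * eta) <= B (f r) l * \det (mxsub (upd f r l) g G).
Proof.
move=> [B0 Bge] Bd BK eta0 hf hG.
have K0 : 0 <= K by exact: le_trans (BK (f r) (f r)).
have [far|] := boolP (((f r).+1 < l)%N || (l.+1 < f r)%N).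
  by rewrite B0// mul0r oppr_le0 mulr_ge0.
rewrite negb_or -!leqNgt => /andP[n1 n2].
have Bl : 0 <= B (f r) l.
  have [<-//|ne] := eqVneq (f r) l; apply: Bge.
  by move: ne; rewrite -(inj_eq val_inj) /=; lia.
have [/existsP[r' /andP[rr' /eqP fr']]|/existsPn nex] :=
    boolP [exists r', (r' != r) && (f r' == l)].
  rewrite (determinant_alternate rr') ?mulr0 ?oppr_le0 ?mulr_ge0//.
  by move=> j; rewrite !mxE /upd eqxx (negPf rr') fr'.
have hu : {homo upd f r l : i j / (i < j)%N}.
  have nf i : i != r -> f i <> l :> nat.
    by move=> ir /val_inj E; have := nex i; rewrite ir E eqxx.
  move=> i j ij; rewrite /upd.
  have [ei|ni] := eqVneq i r; have [ej|nj] := eqVneq j r.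
  - by move: ij; rewrite ei ej ltnn.
  - have := hf _ _ ij; rewrite ei; have := nf _ nj; lia.
  - have := hf _ _ ij; rewrite ej; have := nf _ ni; lia.
  - exact: hf.
(* The coefficient lies between 0 and [K], so the deficit [eta] of the minor is amplified at most
   [K] times. *)
apply: le_trans (_ : B (f r) l * - eta <= _); last by rewrite ler_wpM2l// hG.
by rewrite mulrN lerN2 ler_wpM2r.
Qed.

Lemma norm_det_le k (M : 'M[R]_k) (B : R) : (forall i j, `|M i j| <= B) ->
  `|\det M| <= #|{: 'S_k}|%:R * B ^+ k.
Proof.
move=> hM; apply: le_trans (ler_norm_sum _ _ _) _.
have -> : #|{: 'S_k}|%:R * B ^+ k = \sum_(s : 'S_k) B ^+ k.
  by rewrite sumr_const mulr_natl.
apply: ler_sum => s _; rewrite normrM normrX normrN1 expr1n mul1r normr_prod.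
have -> : B ^+ k = \prod_(i < k) B by rewrite prodr_const card_ord.
by apply: ler_prod => i _; rewrite normr_ge0 hM.
Qed.

End Minors.

(** * Nonnegativity of the minors of solutions *)

Section TN.
Context {R : realType} {n : nat}.
Implicit Types (c d t : R) (A F G : R -> 'M[R]_n).

Lemma lip_det c d k (m : 'I_k -> 'I_k -> R -> R) : c <= d ->
  (forall i j, lip c d (m i j)) ->
  lip c d (fun t => \det (\matrix_(i, j) m i j t)).
Proof.
move=> cd h.
have -> : (fun t => \det (\matrix_(i, j) m i j t)) =
    (fun t => \sum_(s : 'S_k) (-1) ^+ s * \prod_i m i (s i) t).
  apply/funext => t; apply: eq_bigr => s _; congr (_ * _).
  by apply: eq_bigr => i _; rewrite mxE.
apply: lip_sum => s; apply: lipM => //; first exact: lip_cst.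
by apply: lip_prod.
Qed.

(** A one-sided form of the contraction. With the columns [g] fixed, a lower bound [- eta * ch] on
    all minors bounds their derivatives from below; integrating from nonnegative initial values
    yields the same bound with [eta] halved. *)
Lemma nneg_tridiag_minor_ge0 c d A G (K : R) : c <= d ->
  linear_ode c d A G -> ess_bounded_by c d A K ->
  {ae @lebesgue_measure R, forall x, c < x < d ->
     tridiag_nneg_offdiag (A x) /\ forall i, 0 <= A x i i} ->
  (forall k (f g : 'I_k -> 'I_n), {homo f : i j / (i < j)%N} ->
     {homo g : i j / (i < j)%N} -> 0 <= \det (mxsub f g (G c))) ->
  totally_nonnegative (G d).
Proof.
move=> cd lG bA tri G0 k f g hf hg.
have lipG := linear_ode_lip cd lG bA; have [acG dG] := lG.
have [B B0 hB] := mx_abs_continuous_bounded cd acG.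
pose S := #|{: 'S_k}|%:R * B ^+ k; have S0 : 0 <= S by rewrite mulr_ge0 ?exprn_ge0.
(* The derivative of a minor is a sum of [k * n] minors with coefficients of size at most [|K|]. *)
pose L := k%:R * n%:R * `|K|; have L0 : 0 <= L by rewrite !mulr_ge0.
pose M := 2 * L.
have lipdet (f' : 'I_k -> 'I_n) t : t <= d ->
    lip c d (fun t => \det (mxsub f' g (G t))).
  by move=> td; apply: lip_det.
have bound m : forall f' : 'I_k -> 'I_n, {homo f' : i j / (i < j)%N} ->
    forall t, c <= t -> t <= d ->
    - (S / 2 ^+ m * ch M c t) <= \det (mxsub f' g (G t)).
  elim: m => [|m ih] f' hf' t ct td.
    rewrite expr0 divr1 lerNl; apply: le_trans (_ : S <= _).
      apply: le_trans (ler_norm _) _; rewrite normrN.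
      by apply: norm_det_le => i j; rewrite mxE hB.
    by rewrite ler_peMr// ch_ge1.
  pose C := S / 2 ^+ m.+1; rewrite -/C.
  have C0 : 0 <= C by rewrite divr_ge0// exprn_ge0.
  have : C * sh M c c + \det (mxsub f' g (G c)) <=
         C * sh M c t + \det (mxsub f' g (G t)).
    apply: (@ae_derive_ge0_le _ c t
      (fun t => C * sh M c t + \det (mxsub f' g (G t)))) => //.
      apply: (@abs_continuousD _ c t (fun t => C * sh M c t)).
        apply: lip_abs_continuous; exact: lip_sh.
      by apply: (abs_continuousS (lexx c) td); exact/lip_abs_continuous/lipdet.
    apply: (aeS (ae_and (ae_and dG bA) tri)) => x [[h1 h2] h3] /andP[cx xt].
    have cxd : c < x < d by rewrite cx (lt_le_trans xt).
    have {}h1 := h1 cxd; have {}h2 := h2 cxd; have [{}h3 h4] := h3 cxd.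
    have := is_deriveD (is_derive_sh C M c x)
      (is_derive_det (fun i j => h1 (f' i) (g j))).
    set D := (X in is_derive _ _ _ X) => hD; exists D; last exact: hD.
    (* Since [M] is twice [L] and [C] is half of [S / 2 ^+ m], the derivative of [C * sh] offsets
       exactly the worst case of the [k * n] terms. *)
    have -> : 0 = C * (M * ch M c x) +
        \sum_(r < k) \sum_(l < n) - (`|K| * (S / 2 ^+ m * ch M c x)).
      rewrite !sumr_const !card_ord -[_ *+ n]mulr_natl -[_ *+ k]mulr_natl.
      rewrite /C /M /L exprS.
      have : (2 : R) ^+ m != 0 by rewrite expf_neq0.
      set q := ch _ _ _; set p := 2 ^+ m; set w := `|K| => p0.
      by clearbody p q w; field.
    rewrite /D lerD2l; apply: ler_sum => r _; rewrite det_mulmx_row.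
    apply: ler_sum => l _; apply: tridiag_minor_ge => //.
    - by move=> i j; apply: le_trans (ler_norm _) _; apply: le_trans (ler_norm K); exact: h2.
    - by rewrite mulr_ge0 ?divr_ge0 ?exprn_ge0// (le_trans _ (ch_ge1 _ _ _)).
    - by move=> f'' hf''; apply: ih => //; [exact: ltW|exact: ltW (lt_le_trans xt td)].
  rewrite sh0 mulr0 add0r => h.
  have := G0 k f' g hf' hg => h0.
  have : C * sh M c t <= C * ch M c t.
    rewrite ler_wpM2l// /sh /ch; have := expR_ge0 (- M * (t - c)); lra.
  lra.
apply/ler_addgt0Pr => e e0; have [m hm] := geometric_small (S * ch M c d) e0.
have := bound m f hf d cd (lexx d); rewrite mulrAC; lra.
Qed.

End TN.

Section Shift.
Context {R : realType} {n : nat}.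
Implicit Types (c d t : R) (A F G : R -> 'M[R]_n).

(* Passing to exp (K (t - c)) F replaces A by A + K I, which is entrywise
   nonnegative. *)
Lemma tridiag_totally_nonnegative c d A F (K : R) : c <= d ->
  linear_ode c d A F -> ess_bounded_by c d A K ->
  {ae @lebesgue_measure R, forall x, c < x < d ->
     tridiag_nneg_offdiag (A x)} ->
  F c = 1%:M -> totally_nonnegative (F d).
Proof.
move=> cd lF bA tri Fc.
pose e t := expR (K * (t - c)).
pose G t := e t *: F t.
pose A' t := A t + K%:M.
have lipF := linear_ode_lip cd lF bA; have [_ dF] := lF.
have lG : linear_ode c d A' G.
  split=> [i j|].
    apply: lip_abs_continuous; rewrite /G; under eq_fun do rewrite mxE.
    by apply: lipM => //; exact: lip_expR.
  apply: (aeS dF) => x h cx i j.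
  have := is_deriveM (is_derive_expR_linear K c x) (h cx i j).
  have -> : (fun t => expR (K * (t - c))) * (fun t => F t i j) =
      (fun t => G t i j) by apply/funext => t; rewrite /G mxE.
  move/is_derive_eq; apply.
  rewrite /A' /G -scalemxAr mulmxDl mul_scalar_mx scalerDr scalerA !mxE.
  by rewrite /GRing.scale/= /e; ring.
have bA' : ess_bounded_by c d A' (K + `|K|).
  apply: (aeS bA) => x h cx i j; rewrite !mxE.
  apply: le_trans (ler_normD _ _) _; apply: lerD; first exact: h.
  by case: eqP => _; rewrite ?mulr1n ?mulr0n ?normr0.
have triA' : {ae @lebesgue_measure R, forall x, c < x < d ->
     tridiag_nneg_offdiag (A' x) /\ forall i, 0 <= A' x i i}.
  apply: (aeS (ae_and bA tri)) => x [h1 h2] cx.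
  have [t1 t2] := h2 cx; split; first split.
  - move=> i j ij; rewrite !mxE t1// add0r.
    by have [eij|//] := eqVneq i j; move: ij; rewrite eij; lia.
  - move=> i j ij; rewrite !mxE.
    have [eij|_] := eqVneq i j; first by move: ij; rewrite eij; lia.
    by rewrite addr0 t2.
  - move=> i; rewrite !mxE eqxx mulr1n.
    by have := h1 cx i i; rewrite ler_norml => /andP[]; lra.
have tnG : totally_nonnegative (G d).
  apply: (nneg_tridiag_minor_ge0 cd lG bA' triA') => k f g hf hg.
  rewrite /G /e subrr mulr0 expR0 scale1r Fc; exact: det_mxsub1_ge0.
move=> k f g hf hg; have := tnG k f g hf hg.
have -> : mxsub f g (G d) = e d *: mxsub f g (F d).
  by apply/matrixP => i j; rewrite !mxE.
by rewrite detZ pmulr_rge0// exprn_gt0// expR_gt0.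
Qed.

End Shift.

(** * Existence of solutions *)

Section Primitive.
Context {R : realType}.
Local Notation mu := (@lebesgue_measure R).

(** The entries of [A] are Lebesgue measurable, while the integral below is taken of Borel
    functions. Each sublevel set at a rational threshold is Borel up to a null set, and the
    countably many null sets are removed together. *)
Lemma borel_modification (D : set R) (f : R -> R) (K : R) :
  measurable (D : set (measurableTypeR R)) -> lebesgue_measurable_fun D f ->
  {ae @lebesgue_measure R, forall x, D x -> `|f x| <= K} -> 0 <= K ->
  exists g : R -> R, [/\ measurable_fun setT g, forall x, `|g x| <= K,
    forall x, ~ D x -> g x = 0 &
    {ae @lebesgue_measure R, forall x, D x -> f x = g x}].
Proof.
move=> mD mf [N0 [mN0 N00 hN0]] K0.
have mDl : @measurable _ (lebesgueType R) D.
  apply: sub_sigma_algebra; exists D => //; exists set0; last by rewrite setU0.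
  exact: negligible_set0.
have /(_ _)/cid2-/all_sig2[S mS hS] : forall q : rat, exists2 S : set R,
    measurable (S : set (measurableTypeR R)) &
    exists N, [/\ measurable (N : set (measurableTypeR R)),
      @lebesgue_measure R N = 0%E &
      forall x, ~ N x -> S x <-> D x /\ f x < ratr q].
  move=> q.
  have := mf mDl `]-oo, (ratr q)[%classic (measurable_itv _).
  rewrite [X in X -> _](_ : _ =
    (completed_algebra_gen (@lebesgue_measure R)).-sigma.-measurable
      (D `&` f @^-1` `]-oo, ratr q[))//.
  rewrite g_sigma_completed_algebra_genE => -[S mS [M [N [mN N0' MN]] SM]].
  exists S => //; exists N; split => // x Nx; split=> [Sx|[Dx fx]].
    have : (S `|` M) x by left.
    by rewrite SM => -[Dx]; rewrite /= in_itv.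
  have : (S `|` M) x by rewrite SM; split => //=; rewrite in_itv.
  by case=> // /MN.
have /(_ _)/cid-/all_sig[N hN] := hS.
(* On [E] the bound on [f] holds and every rational sublevel set of [f] agrees with its Borel
   version [S q]. *)
pose E := D `\` (N0 `|` \bigcup_q N q).
have negN : mu.-negligible (N0 `|` \bigcup_q N q).
  apply: negligibleU; first by exists N0; split.
  have : {ae mu, forall x, forall q, ~ N q x}.
    apply: ae_countable => q; have [m1 m2 _] := hN q.
    by exists (N q); split => // x /= /contrapT.
  by apply: negligibleS => x [q _ Nq] /= /(_ q).
have mE : measurable (E : set (measurableTypeR R)).
  apply: measurableD => //; apply: measurableU => //.
  by apply: bigcupT_measurable_rat => q; have [] := hN q.
exists (f \_ E); split.
- apply: (measurable_restrictT f mE).1.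
  apply: (measurability _ (RGenInftyO.measurableE R)) => //.
  move=> _ [_ [r ->] <-].
  rewrite [X in measurable X](_ : _ =
      \bigcup_(q in [set q : rat | ratr q < r]) (E `&` S q)).
    rewrite bigcup_mkcond; apply: bigcupT_measurable_rat => q.
    by case: ifPn => _; [exact: (measurableI _ _ mE (mS q))|exact: measurable0].
  apply/seteqP; split=> x.
      move=> [Ex /=]; rewrite in_itv/= => /rat_in_itvoo[q].
      rewrite in_itv/= => /andP[xq qr]; exists q => //; split => //.
      have [_ _ h] := hN q; apply: (h x _).2; last by split => //; case: Ex.
      by move=> Nx; case: Ex => _; apply; right; exists q.
    move=> [q /= qr [Ex Sx]]; split => //=; rewrite in_itv/=.
    have [_ _ h] := hN q; apply: lt_trans qr.
    apply: (proj2 ((h x _).1 Sx)).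
    by move=> Nx; case: Ex => _; apply; right; exists q.
- move=> x; rewrite patchE; case: ifPn => [|_]; last by rewrite normr0.
  rewrite inE => -[Dx nx]; apply: contrapT => h; apply: nx; left.
  by apply: hN0 => /= /(_ Dx).
- by move=> x Dx; rewrite patchE memNset// => -[].
- apply: negligibleS negN => x /= /not_implyP[Dx fx]; apply: contrapT => nx.
  by apply: fx; rewrite patchE mem_set.
Qed.

(** [H] is the integral from minus infinity, which makes sense because [h] is bounded and vanishes
    off [[c, d]]. Its derivative comes from the fundamental theorem of calculus for the Lebesgue
    integral. *)
Lemma primitive (c d K : R) (h : R -> R) : c <= d -> measurable_fun setT h ->
  (forall x, `|h x| <= K) -> (forall x, ~ (c <= x <= d) -> h x = 0) ->
  exists H : R -> R, (forall x y, x <= y -> `|H y - H x| <= K * (y - x)) /\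
    {ae @lebesgue_measure R, forall x : R, is_derive x 1 H (h x)}.
Proof.
move=> cd mh hK h0.
have finI (u v : R) (b1 b2 : bool) :
    (mu [set` Interval (BSide b1 u) (BSide b2 v)] < +oo)%E.
  rewrite lebesgue_measure_itv/=; case: ifPn => _; last exact: ltry.
  by rewrite -EFinB ltry.
have bndh (B : set R) : [bounded h x | x in B].
  exists K; split; first by rewrite num_real.
  by move=> M KM x _ /=; apply: le_trans (hK x) (ltW KM).
have ih : mu.-integrable setT (EFin \o h).
  have -> : EFin \o h = (EFin \o h) \_ `[c, d].
    apply/funext => x /=; rewrite patchE; case: ifPn => // nx.
    rewrite h0// => cx; move/negP: nx; apply; rewrite inE /= in_itv/=.
    exact: cx.
  apply/integrable_restrict => //=; rewrite setTI.
  apply: measurable_bounded_integrable => //; first exact: finI.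
  exact: measurable_funTS.
have ihS (B : set R) : measurable (B : set (measurableTypeR R)) ->
    mu.-integrable B (EFin \o h).
  by move=> mB; apply: integrableS ih.
pose H x := (\int[mu]_(t in [set` `]-oo, x]]) h t)%R.
exists H; split.
  move=> x y xy.
  have -> : H y - H x = (\int[mu]_(t in [set` `]x, y]]) h t)%R.
    by rewrite /H Rintegral_itvB//; exact: ihS.
  apply: le_trans (le_normr_Rintegral _ _) _ => //; first exact: ihS.
  apply: le_trans (_ : (\int[mu]_(t in [set` `]x, y]]) K)%R <= _).
    apply: le_Rintegral => //.
    - have := ihS _ (measurable_itv `]x, y]).
      by move/integrable_norm; apply.
    - apply: measurable_bounded_integrable => //; first exact: finI.
      exact: bounded_cst.
  rewrite Rintegral_cst//= lebesgue_measure_itv/= lte_fin.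
  have [xy'|] := ltP x y; first by rewrite -EFinB.
  by move=> yx; rewrite mulr0 (@le_anti _ _ x y) ?xy// subrr mulr0.
have loc : locally_integrable [set: R] h.
  by apply: open_integrable_locally => //; exact: openT.
have := FTC1Ny (fun y => ihS _ (measurable_itv `]-oo, y])) loc.
move=> /= hF; apply: (aeS hF) => x [dH Hx]; split => //.
by rewrite -derive1E.
Qed.

End Primitive.

Section GeometricLimit.
Context {R : realType}.

Lemma cvg_geometric_bound (u : nat -> R) (l C : R) :
  (forall k, `|l - u k| <= C / 2 ^+ k) -> u @ \oo --> l.
Proof.
move=> h; apply/cvgrPdist_le => e e0; have [k hk] := geometric_small C e0.
exists k => // m /= km; apply: le_trans (h m) _; apply: le_trans hk.
have C0 : 0 <= C by apply: le_trans (normr_ge0 _) _; have := h 0%N; rewrite expr0 divr1; exact.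
by rewrite ler_wpM2l// lef_pV2 ?posrE ?exprn_gt0// ler_weXn2l// ler1n.
Qed.

(** Nested intervals: the one of radius [2 * C / 2 ^+ k] about [u k] contains its successor, whose
    radius is half as large. The limit is the supremum of the left ends. *)
Lemma geometric_limit (u : nat -> R) (C : R) :
  (forall k, `|u k.+1 - u k| <= C / 2 ^+ k) ->
  exists l, forall k, `|l - u k| <= 2 * C / 2 ^+ k.
Proof.
move=> h; pose v k := u k - 2 * C / 2 ^+ k; pose w k := u k + 2 * C / 2 ^+ k.
have half k : 2 * C / 2 ^+ k.+1 = C / 2 ^+ k.
  by rewrite exprS; field; rewrite expf_neq0.
have vS k m : v k <= v (k + m)%N.
  elim: m => [|m ih]; first by rewrite addn0.
  apply: le_trans ih _; rewrite addnS /v half.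
  by have := h (k + m)%N; rewrite ler_norml => /andP[]; lra.
have wS k m : w (k + m)%N <= w k.
  elim: m => [|m ih]; first by rewrite addn0.
  apply: le_trans ih; rewrite addnS /w half.
  by have := h (k + m)%N; rewrite ler_norml => /andP[]; lra.
have C0 : 0 <= C by apply: le_trans (normr_ge0 _) _; have := h 0%N; rewrite expr0 divr1; exact.
have vw k : v k <= w k.
  have : 0 <= C / 2 ^+ k by rewrite divr_ge0// exprn_ge0.
  by rewrite /v /w; lra.
have hs : has_sup (range v).
  split; first by exists (v 0%N), 0%N.
  exists (w 0%N) => _ [k _ <-]; apply: le_trans (vw k) _.
  by have := wS 0%N k; rewrite add0n.
exists (sup (range v)) => k.
have h1 : v k <= sup (range v) by apply: sup_upper_bound => //; exists k.
have h2 : sup (range v) <= w k.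
  apply: ge_sup; first by exists (v 0%N), 0%N.
  move=> _ [m _ <-]; apply: le_trans (vS m k) _.
  by apply: le_trans (vw _) _; rewrite addnC; exact: wS.
by rewrite ler_norml; move: h1 h2; rewrite /v /w => *; apply/andP; split; lra.
Qed.

Lemma lipschitz_measurable (f : R -> R) (L : R) :
  (forall x y, x <= y -> `|f y - f x| <= L * (y - x)) -> measurable_fun setT f.
Proof.
move=> h; apply: continuous_measurable_fun => x.
apply/cvgrPdist_le => e e0.
have L1 : 0 < `|L| + 1 by rewrite ltr_wpDl.
exists (e / (`|L| + 1)) => /=; first by rewrite divr_gt0.
move=> y /=; rewrite ltr_pdivlMr// => xy; apply: le_trans (ltW xy).
have {}h u v : u <= v -> `|f v - f u| <= `|v - u| * (`|L| + 1).
  move=> uv; apply: le_trans (h _ _ uv) _; rewrite mulrC.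
  rewrite (ger0_norm (_ : 0 <= v - u)) ?subr_ge0// ler_wpM2l ?subr_ge0//.
  by have := ler_norm L; lra.
by have [/h//|/ltW/h] := leP y x; rewrite (distrC (f y)) (distrC y).
Qed.

End GeometricLimit.

(** * Picard iteration on a compact interval *)

Section Picard.
Context {R : realType} {n : nat}.
Implicit Types (c d t : R) (A F G : R -> 'M[R]_n).

Lemma picard_step c d t0 (K B : R) A F : c <= d ->
  (forall i j, measurable_fun setT (fun t => (A t *m F t) i j)) ->
  (forall t i j, `|A t i j| <= K) -> (forall t, ~ (c <= t <= d) -> A t = 0) ->
  (forall t, c <= t -> t <= d -> forall i j, `|F t i j| <= B) ->
  exists G : R -> 'M[R]_n, [/\ G t0 = 1%:M,
    forall i j, lip c d (fun t => G t i j),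
    forall i j, measurable_fun setT (fun t => G t i j) &
    ae_primitive c d A F G].
Proof.
move=> cd mAF AK A0 FB; pose L := n%:R * `|K| * `|B|.
have L0 : 0 <= L by rewrite !mulr_ge0.
have /(_ _)/cid-/all_sig[H hH] : forall ij : 'I_n * 'I_n, exists H : R -> R,
    (forall x y, x <= y -> `|H y - H x| <= L * (y - x)) /\
    {ae @lebesgue_measure R, forall x : R,
       is_derive x 1 H ((A x *m F x) ij.1 ij.2)}.
  move=> ij; apply: (primitive cd) => // x; last first.
    by move=> /A0 ->; rewrite mul0mx mxE.
  have [/andP[cx xd]|/negP nx] := boolP (c <= x <= d); last first.
    by rewrite A0// mul0mx mxE normr0.
  apply: mulmx_entry_le => i j; first by apply: le_trans (ler_norm K).
  by apply: le_trans (ler_norm B); exact: FB.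
pose G t : 'M[R]_n := \matrix_(i, j) ((i == j)%:R + (H (i, j) t - H (i, j) t0)).
have Glip i j x y : x <= y -> `|G y i j - G x i j| <= L * (y - x).
  move=> xy; rewrite !mxE; have [h _] := hH (i, j); apply: le_trans (h _ _ xy).
  by rewrite le_eqVlt; apply/orP; left; apply/eqP; congr `|_|; ring.
exists G; split.
- by apply/matrixP => i j; rewrite !mxE subrr addr0.
- by move=> i j; exists L => // x y _ xy _; exact: Glip.
- by move=> i j; apply: (@lipschitz_measurable _ _ L); exact: Glip.
- have := ae_countable (fun ij => (hH ij).2).
  move=> h; apply: (aeS h) => x hx _ i j.
  have -> : (fun t => G t i j) =
      cst ((i == j)%:R - H (i, j) t0) + H (i, j).
    by apply/funext => t; rewrite mxE /= addrAC addrA.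
  by rewrite -[X in is_derive _ _ _ X]add0r; apply: is_deriveD; exact: hx (i, j).
Qed.

(** The Picard iterates from the constant identity converge geometrically in the weight [ch]. The
    pointwise limit need not be regular a priori, so the solution is taken to be its Picard
    image. *)
Lemma bounded_linear_ode_exists c d t0 (K : R) A : c <= t0 -> t0 <= d ->
  (forall i j, measurable_fun setT (fun t => A t i j)) ->
  (forall t i j, `|A t i j| <= K) -> (forall t, ~ (c <= t <= d) -> A t = 0) ->
  exists G, linear_ode c d A G /\ G t0 = 1%:M.
Proof.
move=> ct0 t0d mA AK A0; have cd := le_trans ct0 t0d.
(* [Q] is what a Picard step asks of its input, and [P] relates input to output. Since [P F G]
   implies [Q G], the step can be iterated. *)
pose Q F := (exists B, forall t, c <= t -> t <= d -> forall i j, `|F t i j| <= B) /\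
  forall i j, measurable_fun setT (fun t => (A t *m F t) i j).
pose P F G := [/\ G t0 = 1%:M, forall i j, lip c d (fun t => G t i j),
    forall i j, measurable_fun setT (fun t => G t i j) & ae_primitive c d A F G].
have mAG G : (forall i j, measurable_fun setT (fun t => G t i j)) ->
    forall i j, measurable_fun setT (fun t => (A t *m G t) i j).
  move=> mG i j.
  have -> : (fun t => (A t *m G t) i j) =
      (fun t => \sum_(l <- index_enum 'I_n) A t i l * G t l j).
    by apply/funext => t; rewrite mxE.
  by apply: measurable_sum => l; exact: measurable_funM.
have PQ F G : P F G -> Q G.
  move=> [_ lG mG _]; split; last exact: mAG.
  have acG i j := lip_abs_continuous (lG i j).
  by have [B _ hB] := mx_abs_continuous_bounded cd acG; exists B.
have /choice[step hstep] : forall F, exists G, Q F -> P F G.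
  move=> F; have [[[B hB] mF]|nQ] := pselect (Q F); last by exists F.
  by have [G hG] := picard_step t0 cd mF AK A0 hB; exists G.
pose X k := iter k step (fun=> 1%:M).
have QX k : Q (X k).
  elim: k => [|k ih] /=; last exact: PQ (hstep _ ih).
  split; last by apply: mAG => i j; exact: measurable_cst.
  exists 1 => t _ _ i j; rewrite /X/= mxE; case: (i == j); rewrite ?normr1 ?normr0//.
have PX k : P (X k) (X k.+1) by exact: hstep.
have bA : ess_bounded_by c d A K by apply: aeW => x _.
pose M := 2 * (n%:R * `|K|).
have acX k i j : abs_continuous c d (fun t => X k.+1 t i j).
  by apply: lip_abs_continuous; have [_ + _ _] := PX k; exact.
have X0 i j : abs_continuous c d (fun t => X 0%N t i j).
  exact/lip_abs_continuous/lip_cst.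
have acX10 i j : abs_continuous c d (fun t => (X 1%N t - X 0%N t) i j).
  have -> : (fun t => (X 1%N t - X 0%N t) i j) =
      (fun t => X 1%N t i j + - X 0%N t i j).
    by apply/funext => t; rewrite !mxE.
  by apply: abs_continuousD; [exact: acX|exact: abs_continuousN].
have [C C0 hC] := mx_abs_continuous_bounded cd acX10.
have halve (C' : R) k : C' / 2 ^+ k.+1 = C' / 2 ^+ k / 2.
  by rewrite exprSr invfM mulrA.
have bound k : forall t, c <= t -> t <= d -> forall i j,
    `|X k.+1 t i j - X k t i j| <= C / 2 ^+ k * ch M t0 t.
  elim: k => [|k ih].
    move=> t ct td i j; rewrite expr0 divr1.
    have := hC t ct td i j; rewrite !mxE => /le_trans; apply.
    by rewrite ler_peMr// ch_ge1.
  have [e1 _ _ d1] := PX k.+1; have [e0 _ _ d0] := PX k.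
  rewrite halve; apply: (ae_primitive_contract _ bA ct0 t0d d1 d0) => //.
    by rewrite divr_ge0// exprn_ge0.
  by rewrite e1 e0.
(* All entrywise limits are chosen at once, with the default value 0 outside [[c, d]]. *)
have /choice[l hl] : forall z : R * ('I_n * 'I_n), exists l : R,
    c <= z.1 -> z.1 <= d ->
    forall k, `|l - X k z.1 z.2.1 z.2.2| <= 2 * (C * ch M t0 z.1) / 2 ^+ k.
  move=> [t [i j]] /=.
  have [/andP[ct td]|/negP nt] := boolP (c <= t <= d); last first.
    by exists 0 => ct td; exfalso; apply: nt; rewrite ct.
  have [|l hl] := @geometric_limit _ (fun k => X k t i j) (C * ch M t0 t).
    by move=> k; rewrite mulrAC; exact: bound.
  by exists l.
pose F t : 'M[R]_n := \matrix_(i, j) l (t, (i, j)).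
have FX k t : c <= t -> t <= d -> forall i j,
    `|F t i j - X k t i j| <= 2 * C / 2 ^+ k * ch M t0 t.
  move=> ct td i j; rewrite mxE mulrAC -(mulrA 2 C).
  exact: (hl (t, (i, j))).
have QF : Q F.
  split.
    have [B hB] : exists B, forall t, c <= t -> t <= d -> ch M t0 t <= B.
      have [B _ hB] := lip_bounded cd (lipD (lip_expR c d M t0) (lip_expR c d (- M) t0)).
      by exists B => t ct td; apply: le_trans (ler_norm _) (hB t ct td).
    have [[B0 hB0] _] := QX 0%N.
    exists (2 * C * B + B0) => t ct td i j.
    rewrite -(subrK (X 0%N t i j) (F t i j)).
    apply: le_trans (ler_normD _ _) _; apply: lerD; last exact: hB0.
    apply: le_trans (FX 0%N t ct td i j) _.
    by rewrite expr0 divr1 ler_wpM2l ?mulr_ge0// hB.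
  move=> i j.
  apply: (@measurable_fun_cvg _ _ _ setT (fun k t => (A t *m X k t) i j)).
    by move=> k; have [_] := QX k; exact.
  move=> t _; have [/andP[ct td]|/negP nt] := boolP (c <= t <= d); last first.
    by rewrite A0// mul0mx; under eq_fun do rewrite mul0mx; exact: cvg_cst.
  apply: (@cvg_geometric_bound _ _ _ (n%:R * K * (2 * C * ch M t0 t))) => k.
  have -> : (A t *m F t) i j - (A t *m X k t) i j = (A t *m (F t - X k t)) i j.
    by rewrite mulmxBr !mxE.
  rewrite -[X in _ <= X]mulrA; apply: mulmx_entry_le => // i' j'; rewrite !mxE.
  by have := FX k t ct td i' j'; rewrite mxE [X in _ <= X -> _]mulrAC.
have [G [Gt0 lG mG dG]] : exists G, P F G by exists (step F); exact: hstep.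
(* By contraction [X k.+1] approaches [G] as well as [F], so the limit is a fixed point. *)
have GF t : c <= t -> t <= d -> G t = F t.
  move=> ct td; apply/matrixP => i j; apply/eqP; rewrite -subr_eq0.
  rewrite -normr_le0; apply/ler_addgt0Pr => e e0; rewrite add0r.
  have [k hk] := geometric_small (2 * C * ch M t0 t) e0.
  have [ek lk _ dk] := PX k.
  have h1 : `|G t i j - X k.+1 t i j| <= 2 * C / 2 ^+ k / 2 * ch M t0 t.
    apply: (ae_primitive_contract _ bA ct0 t0d dG dk) => //.
    - by rewrite divr_ge0 ?mulr_ge0 ?exprn_ge0.
    - by move=> i' j'; exact: lip_abs_continuous.
    - by rewrite Gt0 ek.
    - by move=> x cx xd i' j'; exact: FX.
  have h2 := FX k.+1 t ct td i j; rewrite halve in h2.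
  rewrite -(subrKA (X k.+1 t i j)); apply: le_trans (ler_normD _ _) _.
  rewrite distrC in h2; rewrite (distrC (X k.+1 t i j)).
  by move: hk h1 h2; rewrite mulrAC distrC; lra.
exists G; split => //; split; first by move=> i j; exact: lip_abs_continuous.
apply: (aeS dG) => x h cx; case/andP: (cx) => cx' xd.
by rewrite GF ?ltW//; exact: h.
Qed.

(** Replacing [A] by a bounded Borel modification leaves the equation unchanged at almost every
    point. *)
Lemma linear_ode_exists c d t0 (K : R) A : c <= t0 -> t0 <= d ->
  (forall i j, lebesgue_measurable_fun `[c, d] (fun t => A t i j)) ->
  {ae @lebesgue_measure R, forall t, c <= t <= d -> forall i j, `|A t i j| <= K} ->
  exists G, linear_ode c d A G /\ G t0 = 1%:M.
Proof.
move=> ct0 t0d mA bA.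
have /(_ _)/cid-/all_sig[g hg] : forall ij : 'I_n * 'I_n,
    exists g : R -> R, [/\ measurable_fun setT g, forall x, `|g x| <= `|K|,
    forall x, ~ `[c, d]%classic x -> g x = 0 &
    {ae @lebesgue_measure R, forall x, `[c, d]%classic x -> A x ij.1 ij.2 = g x}].
  move=> ij; apply: borel_modification => //.
  apply: (aeS bA) => x h; rewrite /= in_itv/= => cx.
  by apply: le_trans (ler_norm K); exact: h.
pose A' t : 'M[R]_n := \matrix_(i, j) g (i, j) t.
have [|||G [[acG dG] Gt0]] := @bounded_linear_ode_exists c d t0 `|K| A' ct0 t0d.
- move=> i j; have [+ _ _ _] := hg (i, j); congr measurable_fun.
  by apply/funext => t; rewrite mxE.
- by move=> t i j; rewrite mxE; have [_ + _ _] := hg (i, j); exact.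
- move=> t nt; apply/matrixP => i j; rewrite !mxE.
  by have [_ _ + _] := hg (i, j); apply; rewrite /= in_itv.
exists G; split => //; split => //.
have AA' : {ae @lebesgue_measure R, forall x, forall ij : 'I_n * 'I_n,
    `[c, d]%classic x -> A x ij.1 ij.2 = g ij x}.
  by apply: ae_countable => ij; have [_ _ _] := hg ij.
apply: (aeS (ae_and dG AA')) => x [h1 h2] cx i j.
have -> : A x = A' x.
  apply/matrixP => i' j'; rewrite mxE; apply: (h2 (i', j')).
  by rewrite /= in_itv/=; case/andP: cx => *; rewrite !ltW.
exact: h1.
Qed.

End Picard.

(** * Open intervals with possibly infinite endpoints *)

Section OpenInterval.
Context {R : realType} (a b : \bar R).
Implicit Types (c d s t : R).

Lemma oitv_convex c d t : oitv a b c -> oitv a b d -> c <= t -> t <= d ->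
  oitv a b t.
Proof.
move=> [ac _] [_ db] ct td; split.
  by apply: lt_le_trans ac _; rewrite lee_fin.
by apply: le_lt_trans db; rewrite lee_fin.
Qed.

Lemma oitv_min s t : oitv a b s -> oitv a b t -> oitv a b (Num.min s t).
Proof. by case: leP. Qed.

Lemma oitv_max s t : oitv a b s -> oitv a b t -> oitv a b (Num.max s t).
Proof. by case: leP. Qed.

(** Rational endpoints let almost everywhere statements on compact subintervals be collected over a
    countable family. *)
Lemma oitv_rat_lt t : oitv a b t -> exists2 p : rat,
  oitv a b (ratr p) & ratr p < t.
Proof.
move=> [at_ tb].
have [u [au ut]] : exists u : R, (a <= u%:E)%E /\ u < t.
  case: (a) at_ => [r| |] //=.
    by rewrite lte_fin => rt; exists r.
  by move=> _; exists (t - 1); rewrite leNye; split => //; rewrite ltrBlDr ltrDl.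
have [p] := rat_in_itvoo ut; rewrite in_itv/= => /andP[up pt].
exists p => //; split; first by apply: le_lt_trans au _; rewrite lte_fin.
by apply: lt_trans tb; rewrite lte_fin.
Qed.

Lemma oitv_rat_gt t : oitv a b t -> exists2 p : rat,
  oitv a b (ratr p) & t < ratr p.
Proof.
move=> [at_ tb].
have [u [ub tu]] : exists u : R, (u%:E <= b)%E /\ t < u.
  case: (b) tb => [r| |] //=.
    by rewrite lte_fin => rt; exists r.
  by move=> _; exists (t + 1); rewrite leey; split => //; rewrite ltrDl.
have [p] := rat_in_itvoo tu; rewrite in_itv/= => /andP[tp pu].
exists p => //; split; last by apply: lt_le_trans ub; rewrite lte_fin.
by apply: lt_trans at_ _; rewrite lte_fin.
Qed.

Lemma oitv_nonempty : (a < b)%E -> exists t, oitv a b t.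
Proof.
rewrite /oitv; case: a b => [r| |] [s| |] //=.
- rewrite lte_fin => rs; exists ((r + s) / 2); split; rewrite lte_fin; lra.
- by move=> _; exists (r + 1); rewrite lte_fin ltrDl ltry.
- by move=> _; exists (s - 1); rewrite lte_fin ltrBlDr ltrDl ltNyr.
- by move=> _; exists 0; rewrite ltNyr ltry.
Qed.

End OpenInterval.

(** * Solutions on the whole open interval *)

Section Solutions.
Context {R : realType} {n : nat} (a b : \bar R).
Implicit Types (c d s t : R) (A F G : R -> 'M[R]_n).

Lemma mx_norm_le (M : 'M[R]_n) (K : R) : 0 <= K ->
  (forall i j, `|M i j| <= K) -> `|M| <= K.
Proof.
move=> K0 h; rewrite [leLHS]/Num.Def.normr/= mx_normrE.
by apply: bigmax_le => // -[i j] _.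
Qed.

Lemma linear_odeS c d c' d' A F : c <= c' -> d' <= d ->
  linear_ode c d A F -> linear_ode c' d' A F.
Proof.
move=> cc dd [acF dF]; split=> [i j|]; first exact: abs_continuousS (acF i j).
apply: (aeS dF) => x h /andP[cx xd]; apply: h.
by rewrite (le_lt_trans cc)//=; exact: lt_le_trans dd.
Qed.

Lemma eq_linear_ode c d A F G : (forall t, c <= t -> t <= d -> F t = G t) ->
  linear_ode c d A F -> linear_ode c d A G.
Proof.
move=> FG [acF dF]; split=> [i j e e0|].
  have [r r0 hr] := acF i j e e0; exists r => // m u v uv tr s.
  have := hr m u v uv tr s; congr (_ < _); apply: eq_bigr => k _.
  have [h1 h2 h3] := uv k.
  by rewrite !FG//; [exact: le_trans h3|exact: le_trans h2].
apply: (aeS dF) => x h cx i j; have := h cx i j.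
have /andP[cx' xd] := cx; rewrite FG ?ltW//.
apply: near_eq_is_derive; near=> y; rewrite FG//; apply: ltW; near: y.
  exact: lt_nbhsr.
exact: lt_nbhsl.
Unshelve. all: by end_near. Qed.

Lemma ode_solution_linear_ode A F t0 c d :
  ode_solution a b A t0 F -> oitv a b c -> oitv a b d -> linear_ode c d A F.
Proof.
move=> [acF _ dF] ac db; split=> [i j e e0|].
  have [r r0 hr] := acF c d ac db e e0; exists r => // m u v uv tr s.
  apply: le_lt_trans (hr m u v uv tr s); apply: ler_sum => k _.
  by have := mx_entry_norm_le (F (v k) - F (u k)) i j; rewrite !mxE.
apply: (aeS dF) => x h /andP[cx xd].
by apply/is_derive_mxP/h; exact: oitv_convex ac db (ltW cx) (ltW xd).
Qed.

Lemma locally_ess_boundedP A c d : locally_ess_bounded a b A ->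
  oitv a b c -> oitv a b d -> exists K, {ae @lebesgue_measure R,
    forall t, c <= t <= d -> forall i j, `|A t i j| <= K}.
Proof.
move=> bA ac db; have [K hK] := bA c d ac db; exists K.
apply: (aeS hK) => t h ct i j; exact: le_trans (mx_entry_norm_le _ _ _) (h ct).
Qed.

Lemma locally_ess_bounded_by A c d : locally_ess_bounded a b A ->
  oitv a b c -> oitv a b d -> exists K, ess_bounded_by c d A K.
Proof.
move=> bA ac db; have [K hK] := locally_ess_boundedP bA ac db; exists K.
by apply: (aeS hK) => t h /andP[ct td]; apply: h; rewrite !ltW.
Qed.

Lemma linear_ode_abs_continuous c d A F K : c <= d -> linear_ode c d A F ->
  ess_bounded_by c d A K -> abs_continuous c d F.
Proof.
move=> cd lF bA.
have /(_ _)/cid2-/all_sig2[L L0 hL] :=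
  fun ij : 'I_n * 'I_n => linear_ode_lip cd lF bA ij.1 ij.2.
have [S0 hS] : 0 <= \sum_ij L ij /\ forall ij, L ij <= \sum_ij L ij.
  by split=> [|ij]; [exact: sumr_ge0|rewrite (bigD1 ij)//= lerDl sumr_ge0].
apply: lip_abs_continuous; exists (\sum_ij L ij) => // x y cx xy yd.
have yx0 : 0 <= y - x by rewrite subr_ge0.
apply: mx_norm_le => [|i j]; first by rewrite mulr_ge0.
rewrite !mxE; apply: le_trans (hL (i, j) x y cx xy yd) _.
by rewrite ler_wpM2r.
Qed.

(** Solutions on compact subintervals containing [t0] agree where they overlap, by uniqueness, and
    are glued. *)
Lemma ode_solution_exists A t0 : measurable_mx (oitv a b) A ->
  locally_ess_bounded a b A -> oitv a b t0 ->
  exists F, ode_solution a b A t0 F.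
Proof.
move=> mA bA abt0.
have /choice[X hX] : forall cd : R * R, exists F,
    oitv a b cd.1 -> oitv a b cd.2 -> cd.1 <= t0 -> t0 <= cd.2 ->
    linear_ode cd.1 cd.2 A F /\ F t0 = 1%:M.
  move=> [c d] /=.
  have [[[[ac db] ct0] t0d]|no] :=
      pselect (((oitv a b c /\ oitv a b d) /\ c <= t0) /\ t0 <= d); last first.
    by exists (fun=> 0) => *; exfalso; apply: no.
  have [K bK] := locally_ess_boundedP bA ac db.
  have [|F hF] := linear_ode_exists ct0 t0d _ bK; last by exists F.
  move=> i j; apply: measurable_funS (mA i j).
    apply: sub_sigma_algebra; exists (oitv a b); last first.
      by exists set0; [exact: negligible_set0|rewrite setU0].
    apply: is_interval_measurable => x y abx aby z /andP[xz zy].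
    exact: oitv_convex abx aby xz zy.
  by move=> t /=; rewrite in_itv/= => /andP[ct td]; exact: oitv_convex ac db ct td.
(* The value at [t] is read off the smallest compact interval that contains both [t] and [t0]. *)
pose F t := X (Num.min t t0, Num.max t t0) t.
have FX c d : oitv a b c -> oitv a b d -> c <= t0 -> t0 <= d ->
    forall t, c <= t -> t <= d -> X (c, d) t = F t.
  move=> ac db ct0 t0d t ct td.
  have abt := oitv_convex ac db ct td.
  have am := oitv_min abt abt0; have bm := oitv_max abt abt0.
  have m1 : Num.min t t0 <= t0 by rewrite ge_min lexx orbT.
  have m2 : t0 <= Num.max t t0 by rewrite le_max lexx orbT.
  have [l1 e1] := hX (c, d) ac db ct0 t0d.
  have [l2 e2] := hX (Num.min t t0, Num.max t t0) am bm m1 m2.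
  have [K bK] := locally_ess_bounded_by bA am bm.
  apply: (linear_ode_uniq _ l2 bK m1 m2).
  - by apply: linear_odeS l1; rewrite ?le_min ?ge_max ?ct ?td.
  - by rewrite e1 e2.
  - by rewrite ge_min lexx.
  - by rewrite le_max lexx.
have lF c d : oitv a b c -> oitv a b d -> c <= t0 -> t0 <= d ->
    linear_ode c d A F.
  move=> ac db ct0 t0d; have [l1 _] := hX (c, d) ac db ct0 t0d.
  exact: eq_linear_ode (FX _ _ ac db ct0 t0d) l1.
exists F; split.
- move=> c d ac db.
  have ac' := oitv_min ac abt0; have db' := oitv_max db abt0.
  have [K bK] := locally_ess_bounded_by bA ac' db'.
  have m1 : Num.min c t0 <= t0 by rewrite ge_min lexx orbT.
  have m2 : t0 <= Num.max d t0 by rewrite le_max lexx orbT.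
  have := linear_ode_abs_continuous (le_trans m1 m2) (lF _ _ ac' db' m1 m2) bK.
  apply: abs_continuousS; first by rewrite ge_min lexx.
  by rewrite le_max lexx.
- have [_ e] := hX (t0, t0) abt0 abt0 (lexx _) (lexx _).
  by rewrite /F minxx maxxx e.
(* A single null set serves all intervals with rational endpoints, and every point of the open
   interval is interior to one that contains [t0]. *)
- have h : {ae @lebesgue_measure R, forall (x : R) (pq : rat * rat),
      oitv a b (ratr pq.1) -> oitv a b (ratr pq.2) ->
      ratr pq.1 <= t0 -> t0 <= ratr pq.2 -> ratr pq.1 < x < ratr pq.2 ->
      forall i j, is_derive x 1 (fun t => F t i j) ((A x *m F x) i j)}.
    apply: ae_countable => -[p q] /=.
    have [[[[ap bq] pt0] t0q]|no] := pselect (((oitv a b (ratr p) /\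
        oitv a b (ratr q)) /\ ratr p <= t0) /\ t0 <= ratr q); last first.
      by apply: aeW => x *; exfalso; apply: no.
    by have [_ dF] := lF _ _ ap bq pt0 t0q; apply: (aeS dF) => x hx *; exact: hx.
  apply: (aeS h) => x hx abx; apply/is_derive_mxP.
  have [p ap] := oitv_rat_lt (oitv_min abx abt0).
  have [q aq] := oitv_rat_gt (oitv_max abx abt0).
  rewrite lt_min gt_max => /andP[xq t0q] /andP[px pt0].
  by apply: (hx (p, q)); rewrite ?px// ltW.
Qed.

End Solutions.

(** * Necessity *)

Section Necessity.
Context {R : realType} {n : nat}.
Implicit Types (M : 'M[R]_n).

Lemma totally_nonnegative_entry M i j : totally_nonnegative M -> 0 <= M i j.
Proof.
move=> /(_ 1%N (fun=> i) (fun=> j)); rewrite det_mx11 mxE; apply;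
  by move=> x y; rewrite !ord1.
Qed.

Lemma det_mx22 (M : 'M[R]_2) :
  \det M = M ord0 ord0 * M ord_max ord_max - M ord0 ord_max * M ord_max ord0.
Proof.
rewrite (expand_det_row _ ord0) !big_ord_recl big_ord0 /cofactor !det_mx11 !mxE.
have -> : lift ord0 0 = ord_max :> 'I_2 by apply: val_inj.
have -> : lift ord_max 0 = ord0 :> 'I_2 by apply: val_inj.
by rewrite /= expr0 expr1; ring.
Qed.

(** For [i < k < j] this is the minor with rows [i, k] and columns [k, j]; for [j < k < i], the one
    with rows [k, i] and columns [j, k]. *)
Lemma totally_nonnegative_minor2 M (i k j : 'I_n) : totally_nonnegative M ->
  (i < k < j)%N || (j < k < i)%N -> 0 <= M i k * M k j - M i j * M k k.
Proof.
move=> tn; have minor (i1 i2 j1 j2 : 'I_n) : (i1 < i2)%N -> (j1 < j2)%N ->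
    0 <= M i1 j1 * M i2 j2 - M i1 j2 * M i2 j1.
  move=> hi hj.
  have := tn 2%N (fun x : 'I_2 => if x == ord0 then i1 else i2)
    (fun x : 'I_2 => if x == ord0 then j1 else j2).
  rewrite det_mx22 !mxE /=; apply => -[[|[|x]] hx] [[|[|y]] hy] //=.
move=> /orP[] /andP[ik kj]; first exact: minor.
by have := minor k i j k kj ik; rewrite mulrC [M k k * _]mulrC.
Qed.

(** If [D] were negative, the expansion with tolerance [- D / 2] would give
    [f (t + h) <= D * h / 2 < 0] for a small [h > 0]. *)
Lemma is_derive_ge0_right (f : R -> R) (t r D : R) : is_derive t 1 f D ->
  f t = 0 -> 0 < r -> (forall s, t <= s -> s < t + r -> 0 <= f s) -> 0 <= D.
Proof.
move=> fD ft r0 fge; rewrite leNgt; apply/negP => D0.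
have e0 : 0 < - D / 2 by rewrite divr_gt0// oppr_gt0.
have [d d0 hd] := is_derive_approx fD e0.
pose h := Num.min d r / 2.
have m0 : 0 < Num.min d r by rewrite lt_min d0.
have h0 : 0 < h by rewrite divr_gt0.
have hm : h < Num.min d r by rewrite /h; lra.
have := hm; rewrite lt_min => /andP[hd' hr].
have := hd (t + h); rewrite addrAC subrr add0r ft subr0 (gtr0_norm h0).
move=> /(_ hd'); rewrite ler_norml => /andP[_ h2].
have := fge (t + h); rewrite lerDl ltrD2l => /(_ (ltW h0) hr).
have : D * h < 0 by rewrite nmulr_rlt0.
lra.
Qed.

Lemma tridiag_of_totally_nonnegative (Q : R -> 'M[R]_n) M t r : 0 < r ->
  Q t = 1%:M -> (forall i j, is_derive t 1 (fun s => Q s i j) (M i j)) ->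
  (forall s, t <= s -> s < t + r -> totally_nonnegative (Q s)) ->
  tridiag_nneg_offdiag M.
Proof.
move=> r0 Qt dQ tn.
have offdiag i j : i != j -> 0 <= M i j.
  move=> ij; apply: (is_derive_ge0_right (dQ i j) _ r0).
    by rewrite Qt mxE (negPf ij).
  by move=> s ts st; apply: totally_nonnegative_entry; exact: tn.
split=> i j ij; last first.
  by apply: offdiag; apply: contraTneq ij => ->; lia.
(* The successor of the smaller index lies strictly between the two. *)
have [k hk] : exists k : 'I_n, (i < k < j)%N || (j < k < i)%N.
  have [lt|nlt] := boolP (i.+1 < j)%N.
    have lt' : (i.+1 < n)%N by apply: ltn_trans lt _.
    by exists (Ordinal lt') => /=; lia.
  have lt : (j.+1 < i)%N by move: ij nlt; lia.
  have lt' : (j.+1 < n)%N by apply: ltn_trans lt _.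
  by exists (Ordinal lt') => /=; lia.
have [ik kj nij] : [/\ i != k, k != j & i != j].
  by rewrite -!(inj_eq val_inj) /=; split; lia.
apply/eqP; rewrite eq_le offdiag// andbT -oppr_ge0.
(* At [Q t = 1%:M] the only nonzero factor of the minor is [Q t k k], so its derivative there is
   [- M i j]. *)
have := is_deriveB (is_deriveM (dQ i k) (dQ k j)) (is_deriveM (dQ i j) (dQ k k)).
rewrite Qt !mxE eqxx (negPf ik) (negPf kj) (negPf nij) !scale0r scale1r.
rewrite !add0r => dw; apply: (is_derive_ge0_right dw _ r0).
  rewrite -[LHS]/(Q t i k * Q t k j - Q t i j * Q t k k).
  by rewrite Qt !mxE eqxx (negPf ik) (negPf kj) (negPf nij) !mul0r subrr.
by move=> s ts st; apply: totally_nonnegative_minor2 => //; exact: tn.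
Qed.

End Necessity.

(** * The cocycle identity and the equivalence *)

Section Main.
Context {R : realType} {n : nat} (a b : \bar R).
Implicit Types (c d s t : R) (A F G : R -> 'M[R]_n).

(** As functions of [t], both sides solve the equation and take the value [Phi s u] at [s]. The
    interval from [Num.min s t] to [Num.max s t] covers either order of [s] and [t]. *)
Lemma transition_matrixM A Phi t s u : locally_ess_bounded a b A ->
  transition_matrix a b A Phi -> oitv a b t -> oitv a b s -> oitv a b u ->
  Phi t u = Phi t s *m Phi s u.
Proof.
move=> bA tm abt abs abu.
pose c := Num.min s t; pose d := Num.max s t.
have ac : oitv a b c := oitv_min abs abt; have bd : oitv a b d := oitv_max abs abt.
have cs : c <= s by rewrite /c ge_min lexx.
have ct : c <= t by rewrite /c ge_min lexx orbT.
have sd : s <= d by rewrite /d le_max lexx.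
have td : t <= d by rewrite /d le_max lexx orbT.
have [K bK] := locally_ess_bounded_by bA ac bd.
have lu := ode_solution_linear_ode (tm u abu) ac bd.
have ls := ode_solution_linear_ode (tm s abs) ac bd.
apply: (linear_ode_uniq lu (linear_odeMr (Phi s u) (le_trans cs sd) ls) bK cs sd) => //.
by have [_ -> _] := tm s abs; rewrite mul1mx.
Qed.

End Main.

Theorem theorem7 (R : realType) (n : nat) (a b : \bar R) (A : R -> 'M[R]_n)
    (hab : (a < b)%E)
    (Ameas : measurable_mx (oitv a b) A)
    (Abnd : locally_ess_bounded a b A) :
  TNDS a b A <->
  {ae @lebesgue_measure R, forall t : R,
     oitv a b t -> tridiag_nneg_offdiag (A t)}.
Proof.
split=> [[Phi [tm tn]]|tri].
  have [t0 abt0] := oitv_nonempty hab.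
  have [_ _ dPhi] := tm t0 abt0.
  apply: (aeS dPhi) => t h abt.
  have [q abq tq] := oitv_rat_gt abt.
  have PhiV := transition_matrixM Abnd tm _ abt0 abt.
  have PhiI : Phi t t = 1%:M by have [_ + _] := tm t abt.
  (* The exceptional set of the curve [Phi s t] could depend on [t]. Factoring through the fixed
     [t0] leaves only the null set of [Phi s t0]. *)
  apply: (@tridiag_of_totally_nonnegative _ _ (fun s => Phi s t0 *m Phi t0 t) _ t
    (ratr q - t)).
  - by rewrite subr_gt0.
  - by rewrite -PhiV.
  - move=> i j; have /is_derive_mxP dt := h abt.
    by have := is_derive_mulmxr (Phi t0 t) dt i j; rewrite -mulmxA -PhiV// PhiI mulmx1.
  - move=> s ts; rewrite addrC subrK => sq.
    have abs : oitv a b s := oitv_convex abt abq ts (ltW sq).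
    by rewrite -PhiV//; exact: tn.
have /choice[F hF] : forall t0, exists F, oitv a b t0 -> ode_solution a b A t0 F.
  (* Outside the interval the zero function is an arbitrary default. *)
  move=> t0; have [abt0|no] := pselect (oitv a b t0); last by exists (fun=> 0).
  by have [F hF] := ode_solution_exists Ameas Abnd abt0; exists F.
exists (fun t t0 => F t0 t); split=> [t0 /hF//|t0 t abt0 abt t0t].
have [K bK] := locally_ess_bounded_by Abnd abt0 abt.
apply: (tridiag_totally_nonnegative t0t
  (ode_solution_linear_ode (hF t0 abt0) abt0 abt) bK).
  apply: (aeS tri) => x h /andP[t0x xt].
  by apply: h; exact: oitv_convex abt0 abt (ltW t0x) (ltW xt).
by have [_ + _] := hF t0 abt0.
Qed.
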